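(* Let $\beta\in(1,\beta_* )$, where $\beta_*\approx1.4656$ is the real root of $x^3-x^2-1=0$. Then the measure $\nu_\beta$ on $\Omega\times\Upsilon\times S_\beta$ defined by $\nu_\beta(A)=\mathbb P(\varphi(Z\cap A))$ is the unique $K_\beta$-invariant probability measure of maximal entropy.
   Context: $\vec q_0=(0,0)$, $\vec q_1=(1,0)$, $\vec q_2=(0,1)$; $S_\beta$ is the attractor of the IFS $f_{\vec q_i}(\vec z)=(\vec z+\vec q_i)/\beta$ (here the closed triangle with vertices $(0,0)$, $(\frac1{\beta-1},0)$, $(0,\frac1{\beta-1})$), with Borel $\sigma$-algebra. Subsets of $S_\beta$: $E_0=[0,\frac1\beta)\times[0,\frac1\beta)$; $E_1=\{0\le y<\frac1\beta,\ \frac{1}{\beta(\beta-1)}<x+y\le\frac{1}{\beta-1}\}$; $E_2=\{0\le x<\frac1\beta,\ \frac{1}{\beta(\beta-1)}<x+y\le\frac{1}{\beta-1}\}$; $C_{01}=\{x\ge\frac1\beta,\ 0\le y<\frac1\beta,\ x+y\le\frac{1}{\beta(\beta-1)}\}$; $C_{12}=\{x\ge\frac1\beta,\ y\ge\frac1\beta,\ \frac{1}{\beta(\beta-1)}<x+y\le\frac{1}{\beta-1}\}$; $C_{02}=\{0\le x<\frac1\beta,\ y\ge\frac1\beta,\ x+y\le\frac{1}{\beta(\beta-1)}\}$; $C_{012}=\{x\ge\frac1\beta,\ y\ge\frac1\beta,\ x+y\le\frac{1}{\beta(\beta-1)}\}$; $C=C_{01}\cup C_{12}\cup C_{02}$.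 $\Omega=\{0,1\}^{\mathbb N}$, $\Upsilon=\{0,1,2\}^{\mathbb N}$ with product $\sigma$-algebras and left shifts $\sigma,\sigma'$; $\mathbb P$ is the uniform product measure on $\Upsilon$. $K_\beta$ on $\Omega\times\Upsilon\times S_\beta$: $K_\beta(\omega,\upsilon,\vec z)=(\omega,\upsilon,\beta\vec z-\vec q_i)$ if $\vec z\in E_i$; $(\sigma\omega,\upsilon,\beta\vec z-\vec q_i)$ if $\omega_1=0$, $\vec z\in C_{ij}$ ($ij\in\{01,12,02\}$); $(\sigma\omega,\upsilon,\beta\vec z-\vec q_j)$ if $\omega_1=1$, $\vec z\in C_{ij}$; $(\omega,\sigma'\upsilon,\beta\vec z-\vec q_i)$ if $\vec z\in C_{012}$, $\upsilon_1=i$. The digit $d_1$ is the vector subtracted, $d_n=d_1\circ K_\beta^{n-1}$; $\varphi(\omega,\upsilon,\vec z)=(b_1,b_2,\ldots)\in\Upsilon$ where $d_n(\omega,\upsilon,\vec z)=\vec q_{b_n}$. $Z$ is the set of points whose $K_\beta$-orbit visits $\Omega\times\Upsilon\times C$ infinitely often and $\Omega\times\Upsilon\times C_{012}$ infinitely often. *)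

(* Defs.v *)
From HB Require Import structures.
From mathcomp Require Import all_boot all_order all_algebra.
From mathcomp Require Import all_classical all_reals all_analysis.
Set Implicit Arguments. Unset Strict Implicit. Unset Printing Implicit Defensive.
Import Order.TTheory GRing.Theory Num.Theory numFieldNormedType.Exports.
Local Open Scope classical_set_scope.
Local Open Scope ring_scope.

Definition i0 : 'I_3 := @Ordinal 3 0 isT.
Definition i1 : 'I_3 := @Ordinal 3 1 isT.
Definition i2 : 'I_3 := @Ordinal 3 2 isT.

(* Omega = {0,1}^N, Upsilon = {0,1,2}^N; index 0 stands for the paper's index 1. *)
Definition OmegaT := nat -> bool.
Definition UpsT := nat -> 'I_3.
Definition StateT (R : realType) := (OmegaT * UpsT * (R * R))%type.

HB.instance Definition _ := gen_eqMixin UpsT.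
HB.instance Definition _ := gen_choiceMixin UpsT.
HB.instance Definition _ := isPointed.Build UpsT (fun _ => i0).
HB.instance Definition _ (R : realType) := gen_eqMixin (StateT R).
HB.instance Definition _ (R : realType) := gen_choiceMixin (StateT R).
HB.instance Definition _ (R : realType) :=
  isPointed.Build (StateT R) (fun _ => false, fun _ => i0, (0%R, 0%R)).

Definition cylB (n : nat) (w : n.-tuple bool) : set OmegaT :=
  [set u | forall i : 'I_n, u i = tnth w i].
Definition cyl3 (n : nat) (w : n.-tuple 'I_3) : set UpsT :=
  [set u | forall i : 'I_n, u i = tnth w i].

Definition Ups_gen : set (set UpsT) :=
  [set C | exists n (w : n.-tuple 'I_3), C = cyl3 w].
Notation Ups := (g_sigma_algebraType Ups_gen).

(* generators of the product sigma-algebra (cylinders x cylinders x Borel(R^2));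
   Borel(R^2) is generated by open rectangles *)
Definition State_gen (R : realType) : set (set (StateT R)) :=
  [set C | exists n (u : n.-tuple bool) m (w : m.-tuple 'I_3) (a1 b1 a2 b2 : R),
     C = [set x | cylB u x.1.1 /\ cyl3 w x.1.2 /\
                  a1 < x.2.1 < b1 /\ a2 < x.2.2 < b2]].


Notation State R := (g_sigma_algebraType (@State_gen R)).

Section Defs.
Variable R : realType.
Local Notation StateT := (State R).

Variable beta : R.
Let ib := beta^-1.
Let s := (beta * (beta - 1))^-1.
Let c := (beta - 1)^-1.

Definition inS (z : R * R) : bool := [&& 0 <= z.1, 0 <= z.2 & z.1 + z.2 <= c].
Definition inE0 (z : R * R) : bool :=
  inS z && [&& 0 <= z.1, z.1 < ib, 0 <= z.2 & z.2 < ib].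
Definition inE1 (z : R * R) : bool :=
  inS z && [&& 0 <= z.2, z.2 < ib, s < z.1 + z.2 & z.1 + z.2 <= c].
Definition inE2 (z : R * R) : bool :=
  inS z && [&& 0 <= z.1, z.1 < ib, s < z.1 + z.2 & z.1 + z.2 <= c].
Definition inC01 (z : R * R) : bool :=
  inS z && [&& ib <= z.1, 0 <= z.2, z.2 < ib & z.1 + z.2 <= s].
Definition inC12 (z : R * R) : bool :=
  inS z && [&& ib <= z.1, ib <= z.2, s < z.1 + z.2 & z.1 + z.2 <= c].
Definition inC02 (z : R * R) : bool :=
  inS z && [&& 0 <= z.1, z.1 < ib, ib <= z.2 & z.1 + z.2 <= s].
Definition inC012 (z : R * R) : bool :=
  inS z && [&& ib <= z.1, ib <= z.2 & z.1 + z.2 <= s].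
Definition inC (z : R * R) : bool := [|| inC01 z, inC12 z | inC02 z].

Definition qvec (i : 'I_3) : R * R :=
  if val i == 0%N then (0, 0) else if val i == 1%N then (1, 0) else (0, 1).


(* index b of the digit d_1 = q_b (the vector subtracted by K_beta);
   the value outside Omega x Upsilon x S_beta is irrelevant *)
Definition digit (x : StateT) : 'I_3 :=
  let: (om, up, z) := x in
  if inE0 z then i0 else if inE1 z then i1 else if inE2 z then i2
  else if inC01 z then (if om 0%N then i1 else i0)
  else if inC12 z then (if om 0%N then i2 else i1)
  else if inC02 z then (if om 0%N then i2 else i0)
  else if inC012 z then up 0%N
  else i0.

Definition shiftB (om : OmegaT) : OmegaT := fun n => om n.+1.
Definition shift3 (up : UpsT) : UpsT := fun n => up n.+1.

(* the random map K_beta (outside Omega x Upsilon x S_beta: arbitrary choice) *)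
Definition Kbeta (x : StateT) : StateT :=
  let: (om, up, z) := x in
  let q := qvec (digit x) in
  let z' := (beta * z.1 - q.1, beta * z.2 - q.2) in
  if inC z then (shiftB om, up, z')
  else if inC012 z then (om, shift3 up, z')
  else (om, up, z').

Definition phi (x : StateT) : Ups := fun n => digit (iter n Kbeta x).

Definition Dom : set StateT := [set x | inS x.2].

Definition Zset : set StateT :=
  [set x | Dom x /\
     (forall N, exists2 n, (N <= n)%N & inC (iter n Kbeta x).2) /\
     (forall N, exists2 n, (N <= n)%N & inC012 (iter n Kbeta x).2)].

End Defs.

Section Entropy.
Context {d : measure_display} {T : measurableType d} {R : realType}.

Definition mpreserving (mu : set T -> \bar R) (f : T -> T) :=
  forall A, measurable A -> mu (f @^-1` A) = mu A.

(* finite measurable partition of T, indexed by 'I_k (empty cells allowed) *)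
Definition is_mpartition (k : nat) (P : 'I_k -> set T) :=
  [/\ forall i, measurable (P i),
      forall i j, i != j -> P i `&` P j = set0
    & \bigcup_(i in [set: 'I_k]) P i = setT].

Definition eta_ent (t : R) : R := if t == 0 then 0 else - (t * ln t).

Definition join_cell (f : T -> T) (k n : nat) (P : 'I_k -> set T)
  (w : {ffun 'I_n -> 'I_k}) : set T :=
  [set x | forall i : 'I_n, P (w i) (iter i f x)].

Definition Hjoin (mu : set T -> \bar R) (f : T -> T) (k n : nat)
  (P : 'I_k -> set T) : R :=
  \sum_(w : {ffun 'I_n -> 'I_k}) eta_ent (fine (mu (join_cell f P w))).

Definition ent_part (mu : set T -> \bar R) (f : T -> T) (k : nat)
  (P : 'I_k -> set T) : R :=
  limn (fun n : nat => Hjoin mu f n.+1 P / n.+1%:R).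

Definition ks_entropy (mu : set T -> \bar R) (f : T -> T) : \bar R :=
  ereal_sup [set e | exists k (P : 'I_k -> set T),
                       is_mpartition P /\ e = (ent_part mu f P)%:E].

End Entropy.

(* Main.v *)
Require Import Defs.
From HB Require Import structures.
From mathcomp Require Import all_boot all_order all_algebra.
From mathcomp Require Import all_classical all_reals all_analysis.
From mathcomp Require Import measurable_realfun ring lra zify.
Set Implicit Arguments. Unset Strict Implicit. Unset Printing Implicit Defensive.
Import Order.TTheory GRing.Theory Num.Theory numFieldNormedType.Exports.
Local Open Scope classical_set_scope.
Local Open Scope ring_scope.

(* In barycentric coordinates [t_i] (normalised to sum to [1/(beta-1)]) the cell
   of a point is decided by which [t_i] are at least [1/beta], and the point with
   code [b] has [t_i = sum_(b_k = i) beta^-(k+1)].  Reading the coins off the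
   visits to C and C_012 gives a measurable section [psi] of [phi], inverse to
   it on Z, so nu_beta is the image of P under [psi]; Z has full measure because
   some words force a visit to C, resp. to C_012 (the latter is where
   beta < beta_* enters), and they recur P-almost surely.

   For any invariant mu, relatively to the digits the system has zero entropy:
   the cells are functions of the digit sequence, hence approximated by finitely
   many digits, and the coins tossed before time n can be read off the digits and
   cells before time n, so a block of length n of the first N coins adds only the
   2N coins still unread at time n.  Hence h(mu) <= H(n digits)/n <= ln 3 for
   every n, and h(mu) = ln 3 forces the digits to be uniform, i.e. phi_* mu = P;
   then mu(Z) = 1 and mu = nu_beta. *)

(** * Entropy of finite distributions *)

(** The coins cannot be predicted forwards from the digits; the remedy is to go backwards in time.
    They form queues that a step advances by at most one place, so a single window of coins at the
    end of a block restores the first coins at all earlier times, at a cost that does not grow with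
    the length of the block. The constant [beta_*] comes from the word 0 1 2 1 2 2 2 ...: its
    coordinate 1 is [beta^-2 + beta^-4], which exceeds [1/beta] exactly when [beta^3 < beta^2 + 1].
    The same inequality gives [beta < 3/2]; then three coordinates below [1/beta] cannot add up to
    [1/(beta-1)], so the cells cover the triangle. *)

Section FiniteEntropy.
Variable R : realType.
Implicit Types (t p q : R).

Lemma eta_entE t : eta_ent t = - (t * ln t).
Proof. by rewrite /eta_ent; case: eqP => [->|//]; rewrite mul0r oppr0. Qed.

Lemma eta_ent_ge0 t : 0 <= t -> t <= 1 -> 0 <= eta_ent t.
Proof.
by move=> t0 t1; rewrite eta_entE oppr_ge0 mulr_ge0_le0// ln_le0.
Qed.

(** This is [ln x <= x - 1] at [x = q / p], scaled by [p]. Summed over two distributions it gives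
    the nonnegativity of relative entropy; the last hypothesis is absolute continuity. *)
Lemma gibbs_term p q : 0 <= p -> 0 <= q -> (q = 0 -> p = 0) ->
  p * ln q - p * ln p <= q - p.
Proof.
move=> p0 q0 qp; have [->|pn0] := eqVneq p 0; first by rewrite !mul0r !subr0.
have pp : 0 < p by rewrite lt_neqAle eq_sym pn0.
have qq : 0 < q by rewrite lt_neqAle q0 andbT eq_sym; apply: contra_neq pn0.
rewrite -mulrBr -ln_div ?posrE//.
have h : ln (q / p) <= q / p - 1.
  have := @le_ln1Dx R (q / p - 1); rewrite addrCA subrr addr0; apply.
  by have := divr_gt0 qq pp; lra.
have := ler_wpM2l p0 h; rewrite mulrBr mulr1.
by rewrite (_ : p * (q / p) = q) //; field.
Qed.

(** The inequality [1 + x < expR x] is strict for [x != 0]; apply it to [x = ln (q / p)]. *)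
Lemma gibbs_term_eq p q : 0 <= p -> 0 < q ->
  p * ln q - p * ln p = q - p -> p = q.
Proof.
move=> p0 qq; have [->|pn0] := eqVneq p 0.
  by rewrite !mul0r !subr0 => h; rewrite -h ltxx in qq.
have pp : 0 < p by rewrite lt_neqAle eq_sym pn0.
rewrite -mulrBr -ln_div ?posrE//.
have -> : q - p = p * (q / p - 1) by field.
move=> /(mulfI pn0) h.
have qp : 0 < q / p by exact: divr_gt0.
have [e|ne] := eqVneq (ln (q / p)) 0.
  have : q / p = 1 by rewrite -(lnK qp) e expR0.
  by move=> /divr1_eq.
have := expR_gt1Dx ne; rewrite lnK // h; lra.
Qed.

(** With [u] the square root of [t], [- t ln t = 2u * (- u ln u) <= 2u (1 - u) <= 2u], which is at
    most [e] as soon as [t <= (e / 2)^2]. *)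
Lemma eta_ent_small (e : R) : 0 < e ->
  exists2 del : R, 0 < del & forall t, 0 <= t -> t <= del -> eta_ent t <= e.
Proof.
move=> e0; exists ((e / 2) ^+ 2) => [|t t0 tle]; first by rewrite exprn_gt0 // divr_gt0.
rewrite eta_entE; have [->|tn0] := eqVneq t 0; first by rewrite mul0r oppr0 ltW.
have tp : 0 < t by rewrite lt_neqAle eq_sym tn0.
have st : Num.sqrt t <= e / 2.
  have -> : e / 2 = Num.sqrt ((e / 2) ^+ 2) by rewrite sqrtr_sqr ger0_norm; lra.
  by rewrite ler_wsqrtr.
set u := Num.sqrt t in st *.
have up : 0 < u by rewrite sqrtr_gt0.
have tu : t = u ^+ 2 by rewrite sqr_sqrtr.
have := @gibbs_term u 1 (ltW up) ler01; rewrite ln1 mulr0 sub0r => h.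
have {}h : - (u * ln u) <= 1 - u by apply: h => /eqP; rewrite oner_eq0.
rewrite tu lnXn //.
have -> : - (u ^+ 2 * (ln u *+ 2)) = 2 * u * - (u * ln u) by rewrite -mulr_natr; ring.
nra.
Qed.

(** Mutual information is nonnegative: sum Gibbs' inequality for the joint law against the product
    of its marginals. Both have mass 1, so the right-hand sides cancel. *)
Lemma entropy_joint_le (F G : finType) (p : F -> G -> R) :
  (forall a b, 0 <= p a b) -> \sum_a \sum_b p a b = 1 ->
  \sum_a \sum_b eta_ent (p a b) <=
  \sum_a eta_ent (\sum_b p a b) + \sum_b eta_ent (\sum_a p a b).
Proof.
move=> p0 p1.
pose r a := \sum_b p a b; pose c b := \sum_a p a b.
have r0 a : 0 <= r a by apply: sumr_ge0.
have c0 b : 0 <= c b by apply: sumr_ge0.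
have r0p a b : r a = 0 -> p a b = 0.
  move=> /eqP; rewrite psumr_eq0 // => /allP/(_ b (mem_index_enum _))/eqP.
  by [].
have c0p a b : c b = 0 -> p a b = 0.
  by move=> /eqP; rewrite psumr_eq0 // => /allP/(_ a (mem_index_enum _))/eqP.
have key a b : p a b * ln (r a) + p a b * ln (c b) - p a b * ln (p a b)
    <= r a * c b - p a b.
  have [pe|pn] := eqVneq (p a b) 0.
    by rewrite pe !mul0r !addr0 !subr0 mulr_ge0.
  have rp : 0 < r a.
    by rewrite lt_neqAle r0 eq_sym andbT; apply: contra_neq pn => /r0p.
  have cp : 0 < c b.
    by rewrite lt_neqAle c0 eq_sym andbT; apply: contra_neq pn => /c0p.
  rewrite -mulrDr -lnM ?posrE //; apply: gibbs_term => //.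
    by rewrite mulr_ge0.
  by move/eqP; rewrite mulf_eq0 (gt_eqF rp) (gt_eqF cp).
have := ler_sum (index_enum F) (P := xpredT) (fun a _ => ler_sum (index_enum G)
   (P := xpredT) (fun b _ => key a b)).
have -> : \sum_a \sum_b (r a * c b - p a b) = 0.
  under eq_bigr do rewrite sumrB -mulr_sumr.
  rewrite sumrB p1 -mulr_suml p1 mul1r /c exchange_big /= p1; lra.
under eq_bigr do rewrite sumrB big_split /= -mulr_suml.
rewrite sumrB big_split /= [X in _ + X - _]exchange_big /=.
under [X in _ + X - _]eq_bigr do rewrite -mulr_suml.
under [X in _ <= X + _]eq_bigr do rewrite eta_entE.
under [X in _ <= _ + X]eq_bigr do rewrite eta_entE.
under [X in _ -> X <= _]eq_bigr do under eq_bigr do rewrite eta_entE.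
under [X in _ -> X <= _]eq_bigr do rewrite sumrN.
rewrite !sumrN /r /c; lra.
Qed.

(** Each [p b] is at most the sum and [ln] is monotone; hence refining a partition does not decrease
    its entropy. *)
Lemma eta_ent_sum_le (G : finType) (p : G -> R) : (forall b, 0 <= p b) ->
  eta_ent (\sum_b p b) <= \sum_b eta_ent (p b).
Proof.
move=> p0; rewrite eta_entE mulr_suml -sumrN; apply: ler_sum => b _.
rewrite eta_entE lerN2; have [->|pn] := eqVneq (p b) 0; first by rewrite !mul0r.
have pp : 0 < p b by rewrite lt_neqAle eq_sym pn p0.
have ple : p b <= \sum_b p b by rewrite (bigD1 b) //= lerDl sumr_ge0.
by apply: ler_wpM2l => //; rewrite ler_ln // posrE // (lt_le_trans pp).
Qed.

(* [t a >= 0] is the Gibbs defect at [a]; the defects add up to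
   [ln #|F| - H], so they all vanish in the equality case. *)
Lemma entropy_uniform (F : finType) (p : F -> R) :
  (forall a, 0 <= p a) -> \sum_a p a = 1 ->
  \sum_a eta_ent (p a) <= ln #|F|%:R /\
  (ln #|F|%:R <= \sum_a eta_ent (p a) -> forall a, p a = #|F|%:R^-1).
Proof.
move=> p0 p1.
have [F0|Fn0] := posnP #|F|.
  by have := p1; rewrite big_pred0 => [/eqP|a]; rewrite 1?eq_sym ?oner_eq0//;
     have := fintype0 a F0.
have N0 : 0 < #|F|%:R :> R by rewrite ltr0n.
set N : R := #|F|%:R in N0 *.
have Ni : 0 < N^-1 by rewrite invr_gt0.
pose t a := (N^-1 - p a) - (p a * ln N^-1 - p a * ln (p a)).
have t0 a : 0 <= t a.
  rewrite subr_ge0; apply: gibbs_term => //; first exact: ltW.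
  by move=> h; rewrite h ltxx in Ni.
have ts : \sum_a t a = ln N - \sum_a eta_ent (p a).
  rewrite /t !sumrB p1 -mulr_suml p1 sumr_const.
  under [in RHS]eq_bigr do rewrite eta_entE.
  rewrite sumrN lnV ?posrE // -(mulr_natr N^-1 #|F|) -/N mulVf ?gt_eqF //; lra.
split=> [|hle a]; first by rewrite -subr_ge0 -ts sumr_ge0.
have : \sum_a t a = 0.
  by apply/eqP; rewrite eq_le sumr_ge0 // andbT ts subr_le0.
move/eqP; rewrite psumr_eq0 // => /allP/(_ a (mem_index_enum _)) /= /eqP h.
apply: gibbs_term_eq => //; move: h; rewrite /t; lra.
Qed.

End FiniteEntropy.

(** * Finite observables *)

Section Observables.
Context {d : measure_display} {T : measurableType d} {R : realType}.

(** Only the fibres matter, so the type of values needs no sigma-algebra. *)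
Definition obs (F : Type) (X : T -> F) :=
  forall a, measurable (X @^-1` [set a]).

Lemma obs_preimage (F : finType) (X : T -> F) (U : set F) :
  obs X -> measurable (X @^-1` U).
Proof.
move=> mX; have -> : X @^-1` U = \bigcup_(a in U) (X @^-1` [set a]).
  apply/seteqP; split=> x /=; first by move=> Ux; exists (X x).
  by move=> [a Ua /= ->].
by apply: fin_bigcup_measurable => //; exact: finite_finset.
Qed.

Lemma obs_comp (F : finType) (G : Type) (X : T -> F) (g : F -> G) :
  obs X -> obs (fun x => g (X x)).
Proof. by move=> mX a; exact: (obs_preimage (g @^-1` [set a]) mX). Qed.

Lemma obs_cst (F : Type) (a : F) : obs (fun=> a).
Proof.
move=> b; have [->|ab] := pselect (a = b).
  by rewrite (_ : _ @^-1` _ = setT) //; apply/seteqP; split.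
by rewrite (_ : _ @^-1` _ = set0) //; apply/seteqP; split.
Qed.

Lemma obs_pair (F G : Type) (X : T -> F) (Y : T -> G) :
  obs X -> obs Y -> obs (fun x => (X x, Y x)).
Proof.
move=> mX mY [a b].
rewrite (_ : _ @^-1` _ = X @^-1` [set a] `&` Y @^-1` [set b]).
  exact: measurableI.
by apply/seteqP; split => x /= [-> ->].
Qed.

Lemma obs_ffun (I : finType) (F : eqType) (X : I -> T -> F) :
  (forall i, obs (X i)) -> obs (fun x => [ffun i => X i x]).
Proof.
move=> mX w.
rewrite (_ : _ @^-1` _ = \bigcap_(i in [set: I]) (X i @^-1` [set w i])).
  by apply: fin_bigcap_measurable => [|i _]; [exact: finite_finset|exact: mX].
apply/seteqP; split => x /=; first by move=> <- i _ /=; rewrite ffunE.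
by move=> h; apply/ffunP => i; rewrite ffunE; exact: h.
Qed.

Lemma obs_bool (p : T -> bool) : measurable [set x | p x] -> obs p.
Proof.
move=> mp [|]; first exact: mp.
rewrite (_ : _ @^-1` _ = ~` [set x | p x]); first exact: measurableC.
by apply/seteqP; split => x /=; [move=> ->|case: (p x)].
Qed.

Variable mu : probability T R.

Local Notation m A := (fine (mu A)).

Lemma prob_le (A B : set T) : measurable A -> measurable B ->
  A `<=` B -> m A <= m B.
Proof.
by move=> mA mB AB; apply: fine_le; rewrite ?fin_num_measure// le_measure ?inE.
Qed.

Lemma prob_ge0 (A : set T) : 0 <= m A.
Proof. exact/fine_ge0/measure_ge0. Qed.

Lemma prob_setU_le (A B : set T) : measurable A -> measurable B ->
  m (A `|` B) <= m A + m B.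
Proof.
move=> mA mB; rewrite -fineD ?fin_num_measure //.
apply: fine_le; last exact: measureU2.
  by rewrite fin_num_measure //; exact: measurableU.
by rewrite fin_numD !fin_num_measure.
Qed.

Lemma prob_sum_obs (F : finType) (X : T -> F) (A : set T) : obs X ->
  measurable A -> m A = \sum_a m (A `&` X @^-1` [set a]).
Proof.
move=> mX mA; have mI a : measurable (A `&` X @^-1` [set a]) by apply: measurableI.
rewrite sum_fine => [|a _]; last by rewrite fin_num_measure.
congr fine; rewrite big_enum_val /= -measure_bigsetU_ord //.
- congr (mu _); rewrite -bigcup_seq; apply/seteqP; split => x /=.
    move=> Ax; exists (enum_rank (X x)); first exact: mem_index_enum.
    by rewrite /= enum_rankK.
  by move=> [i _ []].
- move=> i j _ _ [x [[_ /= h1] [_ /= h2]]].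
  by apply: enum_val_inj; rewrite -h1 -h2.
Qed.

Lemma prob_setT : m [set: T] = 1.
Proof. by rewrite probability_setT. Qed.

Lemma prob_setC (A : set T) : measurable A -> m (~` A) = 1 - m A.
Proof.
by move=> mA; rewrite probability_setC // fineB ?fin_num_measure.
Qed.

Lemma prob_full (S A : set T) : measurable S -> mu S = 1%E -> measurable A ->
  m (A `&` S) = m A.
Proof.
move=> mS muS mA; apply/eqP; rewrite eq_le; apply/andP; split.
  by apply: prob_le => //; exact: measurableI.
have hC : m (~` S) = 0 by rewrite prob_setC // muS /= subrr.
have := prob_setU_le (measurableI _ _ mA mS) (measurableC mS).
rewrite hC addr0; apply: le_trans; apply: prob_le => //.
  by apply: measurableU; [exact: measurableI|exact: measurableC].
by move=> x Ax; have [Sx|nSx] := pselect (S x); [left|right].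
Qed.

Definition ent (F : finType) (X : T -> F) : R :=
  \sum_a eta_ent (m (X @^-1` [set a])).

Lemma sum_obs (F : finType) (X : T -> F) : obs X ->
  \sum_a m (X @^-1` [set a]) = 1.
Proof.
move=> mX; rewrite -prob_setT (prob_sum_obs mX measurableT).
by under [RHS]eq_bigr do rewrite setTI.
Qed.

Lemma ent_ge0 (F : finType) (X : T -> F) : obs X -> 0 <= ent X.
Proof.
move=> mX; apply: sumr_ge0 => a _; apply: eta_ent_ge0; first exact: prob_ge0.
by rewrite -prob_setT; apply: prob_le.
Qed.

Lemma ent_uniform (F : finType) (X : T -> F) : obs X ->
  ent X <= ln #|F|%:R /\
  (ln #|F|%:R <= ent X -> forall a, m (X @^-1` [set a]) = #|F|%:R^-1).
Proof.
by move=> mX; apply: entropy_uniform; [move=> a; exact: prob_ge0|exact: sum_obs].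
Qed.

Lemma ent_pair_le (F G : finType) (X : T -> F) (Y : T -> G) :
  obs X -> obs Y -> ent (fun x => (X x, Y x)) <= ent X + ent Y.
Proof.
move=> mX mY; pose p a b := m (X @^-1` [set a] `&` Y @^-1` [set b]).
have rE a : m (X @^-1` [set a]) = \sum_b p a b by exact: prob_sum_obs.
have cE b : m (Y @^-1` [set b]) = \sum_a p a b.
  by rewrite (prob_sum_obs mX) //; apply: eq_bigr => a _; rewrite setIC.
have -> : ent (fun x => (X x, Y x)) = \sum_a \sum_b eta_ent (p a b).
  rewrite /ent pair_big /=; apply: eq_bigr => -[a b] _; congr (eta_ent (m _)).
  by apply/seteqP; split => x /= [-> ->].
rewrite /ent; under [X in _ <= X + _]eq_bigr do rewrite rE.
under [X in _ + X]eq_bigr do rewrite cE.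
apply: entropy_joint_le => [a b|]; first exact: prob_ge0.
by under eq_bigr do rewrite -rE; exact: sum_obs.
Qed.

Variables (S : set T) (mS : measurable S) (muS : mu S = 1%E).

(** The dependence is only asked on the full set [S]: the state type contains points outside the
    triangle, where [K_beta] is arbitrary. *)
Definition determines (F G : Type) (Y : T -> G) (X : T -> F) :=
  forall x y, S x -> S y -> Y x = Y y -> X x = X y.

(** In the joint law every value of [Y] carries at most one value of [X] with positive mass. The
    joint entropy, which dominates that of [X], therefore equals that of [Y]. *)
Lemma ent_determined (F G : finType) (X : T -> F) (Y : T -> G) :
  obs X -> obs Y -> determines Y X -> ent X <= ent Y.
Proof.
move=> mX mY YX.
pose p a b := m (X @^-1` [set a] `&` Y @^-1` [set b]).
have rE a : m (X @^-1` [set a]) = \sum_b p a b by exact: prob_sum_obs.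
have cE b : m (Y @^-1` [set b]) = \sum_a p a b.
  by rewrite (prob_sum_obs mX) //; apply: eq_bigr => a _; rewrite setIC.
have p0 a b : 0 <= p a b by exact: prob_ge0.
have mI a b : measurable (X @^-1` [set a] `&` Y @^-1` [set b]).
  exact: measurableI.
have uniq_col a a' b : p a b != 0 -> p a' b != 0 -> a = a'.
  rewrite /p -(prob_full mS muS (mI a b)) -(prob_full mS muS (mI a' b)) => h h'.
  have [x [[/= <- Yx] Sx]] : (X @^-1` [set a] `&` Y @^-1` [set b] `&` S) !=set0.
    by apply/set0P; apply: contra_neq h => ->; rewrite measure0.
  have [y [[/= <- Yy] Sy]] : (X @^-1` [set a'] `&` Y @^-1` [set b] `&` S) !=set0.
    by apply/set0P; apply: contra_neq h' => ->; rewrite measure0.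
  by apply: YX; rewrite // Yx Yy.
rewrite /ent; under eq_bigr do rewrite rE; under [leRHS]eq_bigr do rewrite cE.
apply: (@le_trans _ _ (\sum_a \sum_b eta_ent (p a b))).
  by apply: ler_sum => a _; apply: eta_ent_sum_le.
rewrite exchange_big /=; apply: ler_sum => b _.
have [[a pab]|h] := pselect (exists a, p a b != 0).
  have pz a' : a' != a -> p a' b = 0.
    by move=> ne; apply/eqP; apply: contraNT ne => pa'; apply/eqP; exact: uniq_col pa' pab.
  rewrite (bigD1 a) //= [in leRHS](bigD1 a) //=.
  by rewrite !big1 ?addr0 // => a' /pz -> //; rewrite eta_entE mul0r oppr0.
have pz a : p a b = 0 by apply/eqP/negP => /negP h'; apply: h; exists a.
by rewrite !big1 ?eta_entE ?mul0r ?oppr0 // => a _; rewrite pz ?eta_entE ?mul0r ?oppr0.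
Qed.

Lemma ent_determined2 (F G H : finType) (X : T -> F) (Y : T -> G) (Z : T -> H) :
  obs X -> obs Y -> obs Z -> determines (fun x => (Y x, Z x)) X ->
  ent X <= ent Y + ent Z.
Proof.
move=> mX mY mZ h; apply: (le_trans _ (ent_pair_le mY mZ)).
by apply: ent_determined => //; exact: obs_pair.
Qed.

End Observables.

(** * Entropy rates *)

Section EntropyRate.
Context {d : measure_display} {T : measurableType d} {R : realType}.
Variables (mu : probability T R) (f : T -> T).
Hypotheses (mf : measurable_fun [set: T] f) (finv : mpreserving mu f).
Variables (S : set T) (mS : measurable S) (muS : mu S = 1%E).
Hypothesis fS : forall x, S x -> S (f x).
Local Notation m A := (fine (mu A)).
Local Notation ent := (ent mu).
Local Notation determines := (determines S).

Definition block (F : Type) (X : T -> F) n x : {ffun 'I_n -> F} :=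
  [ffun i : 'I_n => X (iter i f x)].

Lemma iter_stable n x : S x -> S (iter n f x).
Proof. by move=> Sx; elim: n => //= n; exact: fS. Qed.

Lemma measurable_iter n : measurable_fun [set: T] (iter n f).
Proof.
elim: n => [|n IH]; first exact: measurable_id.
exact: (measurableT_comp mf IH).
Qed.

Lemma iter_preserving n : mpreserving mu (iter n f).
Proof.
elim: n => [//|n IH] A mA.
have -> : iter n.+1 f @^-1` A = iter n f @^-1` (f @^-1` A) by [].
by rewrite IH ?finv // -[X in measurable X]setTI; exact: mf.
Qed.

Lemma obs_iter (F : Type) (X : T -> F) n :
  obs X -> obs (fun x => X (iter n f x)).
Proof.
move=> mX a; rewrite -[X in measurable X]setTI.
exact: (measurable_iter n measurableT (mX a)).
Qed.

Lemma obs_block (F : eqType) (X : T -> F) n : obs X -> obs (block X n).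
Proof. by move=> mX; apply: obs_ffun => i; exact: obs_iter. Qed.

Lemma ent_iter (F : finType) (X : T -> F) n : obs X ->
  ent (fun x => X (iter n f x)) = ent X.
Proof.
by move=> mX; apply: eq_bigr => a _; rewrite -(@iter_preserving n (X @^-1` _)).
Qed.

(** The last [b] entries form a block observed [a] steps later, which has the same law by
    invariance. *)
Lemma ent_block_add (F : finType) (X : T -> F) a b : obs X ->
  ent (block X (a + b)) <= ent (block X a) + ent (block X b).
Proof.
move=> mX; rewrite -(@ent_iter _ (block X b) a); last exact: obs_block.
apply: (ent_determined2 mS muS); try exact: obs_block.
  by apply: obs_iter; exact: obs_block.
move=> x y _ _ [/ffunP ha /ffunP hb]; apply/ffunP => i; rewrite !ffunE.
have [ia|ai] := ltnP i a; first by have := ha (Ordinal ia); rewrite !ffunE.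
have ib : (i - a < b)%N by have := ltn_ord i; lia.
by have := hb (Ordinal ib); rewrite !ffunE /= -!iterD subnK.
Qed.

Lemma ent_block_mul (F : finType) (X : T -> F) q n : obs X ->
  ent (block X (q * n)) <= q%:R * ent (block X n).
Proof.
move=> mX; elim: q => [|q IH].
  rewrite mul0r mul0n.
  have [+ _] := ent_uniform mu (@obs_block _ X 0 mX).
  by rewrite card_ffun card_ord expn0 ln1.
rewrite mulSn -natr1 mulrDl mul1r.
by apply: (le_trans (ent_block_add _ _ mX)); rewrite addrC lerD2r.
Qed.

Lemma ent_block_le (F : finType) (X : T -> F) n : obs X ->
  ent (block X n) <= n%:R * ent X.
Proof.
move=> mX; have := ent_block_mul n 1 mX; rewrite muln1 => /le_trans; apply.
rewrite ler_wpM2l // (ent_determined mS muS) //; first exact: obs_block.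
by move=> x y _ _ xy; apply/ffunP => i; rewrite !ffunE ord1.
Qed.

(** This says that the limsup of [ent (block X n) / n] is at most [h], without requiring a limit to
    exist. *)
Definition rate_le (F : finType) (X : T -> F) (h : R) :=
  forall e, 0 < e -> exists N, forall n, (N <= n)%N ->
    ent (block X n) <= n%:R * (h + e).

Lemma archi_mul (e a : R) : 0 < e ->
  exists N, forall n, (N <= n)%N -> a <= n%:R * e.
Proof.
move=> e0; exists (Num.bound (`|a| / e)) => n Nn.
rewrite -ler_pdivrMr //; have : `|a| / e <= n%:R.
  rewrite (le_trans (ltW (archi_boundP _))) ?ler_nat //.
  by rewrite divr_ge0 // ltW.
by apply: le_trans; rewrite ler_pM2r ?invr_gt0 // ler_norm.
Qed.

(** The upper half of Fekete's argument: a block of length [k] is cut into [k %/ n] blocks of length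
    [n], and the remainder has entropy at most [n * ent X], negligible against [k]. *)
Lemma rate_block (F : finType) (X : T -> F) n : obs X -> (0 < n)%N ->
  rate_le X (ent (block X n) / n%:R).
Proof.
move=> mX n0 e e0; have [N hN] := archi_mul (n%:R * ent X) e0.
exists N => k Nk; have nR : 0 < n%:R :> R by rewrite ltr0n.
have := ent_block_add (k %/ n * n) (k %% n) mX.
rewrite -divn_eq => /le_trans; apply.
rewrite mulrDr lerD //.
  apply: (le_trans (ent_block_mul _ _ mX)).
  rewrite mulrCA mulrC ler_wpM2l ?ent_ge0 //; first exact: obs_block.
  by rewrite ler_pdivlMr // -natrM ler_nat leq_trunc_div.
apply: (le_trans (ent_block_le _ mX)); apply: le_trans (hN _ Nk).
by rewrite ler_wpM2r ?ent_ge0 // ler_nat ltnW // ltn_mod.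
Qed.

(* The terminal observable [c], being read only once at time [n], costs a
   bounded amount of entropy, hence nothing in the limit. *)
Lemma rate_window (F G H : finType) (X : T -> F) (Y : T -> G) (c : T -> H) N h :
  obs X -> obs Y -> obs c -> rate_le Y h ->
  (forall n, determines (fun x => (block Y (n + N) x, c (iter n f x)))
                        (block X n)) ->
  rate_le X h.
Proof.
move=> mX mY mc rY XY e e0; have e2 : 0 < e / 2 by rewrite divr_gt0.
have [N1 hN1] := rY _ e2.
have [N2 hN2] := archi_mul (N%:R * (h + e / 2) + ent c) e2.
exists (maxn N1 N2) => n; rewrite geq_max => /andP[n1 n2].
have := ent_determined2 mS muS (obs_block mX) (obs_block mY)
  (obs_iter n mc) (XY n).
rewrite ent_iter // => /le_trans; apply.
have := hN1 (n + N)%N (leq_trans n1 (leq_addr _ _)).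
have := hN2 _ n2; rewrite natrD; lra.
Qed.

(** Reading [X] for [n] steps requires [Y] for [n + N] steps, and a fixed excess does not change the
    rate. *)
Lemma rate_prefix (F G : finType) (X : T -> F) (Y : T -> G) N h :
  obs X -> obs Y -> rate_le Y h -> determines (block Y N) X -> rate_le X h.
Proof.
move=> mX mY rY YX; apply: (rate_window (N := N) mX mY (obs_cst tt) rY).
move=> n x y Sx Sy [/ffunP xy]; apply/ffunP => i; rewrite !ffunE.
apply: YX; [exact: iter_stable|exact: iter_stable|apply/ffunP => j; rewrite !ffunE -!iterD].
have ij : (j + i < n + N)%N by have := ltn_ord i; have := ltn_ord j; lia.
by have := xy (Ordinal ij); rewrite !ffunE.
Qed.

(** [X] is recovered from [X'] together with a correction that is rarely needed. The correction has
    small entropy at a single time, hence a small rate. *)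
Lemma rate_approx (F : finType) (X : T -> F) h : obs X ->
  (forall e, 0 < e -> exists X' : T -> F,
    [/\ obs X', rate_le X' h & m [set x | X x != X' x] <= e]) ->
  rate_le X h.
Proof.
move=> mX happrox e e0.
(* The allowance [e / 2] is shared equally among the [#|F| + 1] values of the correction. *)
pose e1 := e / 2 / (#|F|%:R + 1).
have F1 : 0 < #|F|%:R + 1 :> R by rewrite ltr_wpDl.
have e10 : 0 < e1 by rewrite !divr_gt0.
have [del del0 hdel] := eta_ent_small e10.
have [X' [mX' rX' hX']] := happrox (Num.min e1 del) ltac:(by rewrite lt_min e10).
move: hX'; rewrite le_min => /andP[hXe hXd].
(* The correction: [None] where [X'] is right, the true value elsewhere. *)
pose E x := if X x == X' x then None else Some (X x).
have mE : obs E.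
  exact: (obs_comp (fun p => if p.1 == p.2 then None else Some p.1)
    (obs_pair mX mX')).
have mne : measurable [set x | X x != X' x].
  exact: (obs_preimage [set p | p.1 != p.2] (obs_pair mX mX')).
have entE : ent E <= e / 2.
  have -> : e / 2 = \sum_(a : option F) e1.
    have cE : #|{: option F}|%:R = #|F|%:R + 1 :> R by rewrite card_option -natr1.
    transitivity (e1 * #|{: option F}|%:R); last by rewrite mulr_natr sumr_const.
    by rewrite cE divfK ?gt_eqF.
  apply: ler_sum => -[a|] _.
    apply: hdel; first exact: prob_ge0.
    apply: le_trans hXd; apply: prob_le => // x /=.
    by rewrite /E; case: eqP.
  (* The value [None] has probability [t] close to 1 instead of close to 0: here
     [- t ln t <= 1 - t], which is at most the probability of disagreement. *)
  rewrite eta_entE; set t := m _.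
  have := @gibbs_term R t 1 (prob_ge0 _ _) ler01; rewrite ln1 mulr0 sub0r => h1.
  apply: (le_trans (h1 _)); first by move/eqP; rewrite oner_eq0.
  apply: le_trans hXe; rewrite lerBlDr -(prob_setT mu).
  apply: le_trans (prob_setU_le _ _ _) => //; apply: prob_le => //.
    exact: measurableU.
  by move=> x _ /=; rewrite /E; case: eqP => [|/eqP] h2; [right|left].
have [N hN] := rX' _ (ltac:(by rewrite divr_gt0) : 0 < e / 2).
exists N => n Nn.
have h2 : ent (block X n) <= ent (block X' n) + ent (block E n).
  apply: (ent_determined2 mS muS); try exact: obs_block.
  move=> x y _ _ [/ffunP h1 /ffunP h2]; apply/ffunP => i.
  have := h1 i; have := h2 i; rewrite !ffunE /E.
  by case: eqP => [->|_]; case: eqP => [->|_] //; case=> ->.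
have := hN _ Nn; have := ent_block_le n mE.
have : n%:R * ent E <= n%:R * (e / 2) by rewrite ler_wpM2l.
move: h2; lra.
Qed.

End EntropyRate.

(** * Approximation by cylinder sets *)

Section Approximation.
Context {d : measure_display} {T : measurableType d} {R : realType}.
Variables (mu : probability T R) (L : Type) (g : T -> nat -> L).
Local Notation m A := (fine (mu A)).

Definition agree N x y := forall i, (i < N)%N -> g x i = g y i.

Definition cylindric (A : set T) :=
  exists N, forall x y, agree N x y -> A x -> A y.

Definition symdiff (A B : set T) := (A `\` B) `|` (B `\` A).

(** Measurability is part of the property so that the approximable sets form a sigma-algebra by
    themselves. *)
Definition approximable (A : set T) := measurable A /\
  forall e, 0 < e ->
    exists B, [/\ measurable B, cylindric B & m (symdiff A B) <= e].

Lemma measurable_symdiff (A B : set T) :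
  measurable A -> measurable B -> measurable (symdiff A B).
Proof. by move=> mA mB; apply: measurableU; apply: measurableD. Qed.

Lemma agree_le N N' x y : (N <= N')%N -> agree N' x y -> agree N x y.
Proof. by move=> NN h i iN; apply: h; exact: leq_trans NN. Qed.

Lemma agree_sym N x y : agree N x y -> agree N y x.
Proof. by move=> h i /h ->. Qed.

Lemma symdiff_triangle (A B C : set T) :
  symdiff A C `<=` symdiff A B `|` symdiff B C.
Proof.
move=> x; have [Bx|nBx] := pselect (B x).
  by move=> [[Ax nCx]|[Cx nAx]]; [right; left|left; right].
by move=> [[Ax nCx]|[Cx nAx]]; [left; left|right; right].
Qed.

Lemma prob_symdiff_triangle (A B C : set T) : measurable A -> measurable B ->
  measurable C -> m (symdiff A C) <= m (symdiff A B) + m (symdiff B C).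
Proof.
move=> mA mB mC; apply: le_trans (prob_setU_le _ _ _); rewrite ?measurable_symdiff //.
- apply: prob_le; last exact: symdiff_triangle.
    exact: measurable_symdiff.
  by apply: measurableU; exact: measurable_symdiff.
- exact: measurable_symdiff.
- exact: measurable_symdiff.
Qed.

Lemma cylindric_approximable (A : set T) :
  measurable A -> cylindric A -> approximable A.
Proof.
move=> mA cA; split=> // e e0; exists A; split => //.
by rewrite /symdiff setDv setU0 measure0 ltW.
Qed.

Lemma approximableC (A : set T) : approximable A -> approximable (~` A).
Proof.
move=> [mA hA]; split=> [|e e0]; first exact: measurableC.
have [B [mB [N cB] hB]] := hA e e0; exists (~` B); split.
- exact: measurableC.
- by exists N => x y xy nBx By; apply: nBx; apply: cB By; exact: agree_sym.
- rewrite (_ : symdiff _ _ = symdiff A B) //; apply/seteqP.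
  split => x [[h1 h2]|[h1 h2]].
  + by right; split=> //; exact: contrapT.
  + by left; split=> //; exact: contrapT.
  + by right; split=> // h; apply: h.
  + by left; split=> // h; apply: h.
Qed.

Lemma approximableU (A A' : set T) :
  approximable A -> approximable A' -> approximable (A `|` A').
Proof.
move=> [mA hA] [mA' hA']; split=> [|e e0]; first exact: measurableU.
have e2 : 0 < e / 2 by rewrite divr_gt0.
have [B [mB [N cB] hB]] := hA _ e2.
have [B' [mB' [N' cB'] hB']] := hA' _ e2.
exists (B `|` B'); split; first exact: measurableU.
- exists (maxn N N') => x y xy [Bx|Bx]; [left; apply: cB Bx|right; apply: cB' Bx].
    by apply: agree_le xy; exact: leq_maxl.
  by apply: agree_le xy; exact: leq_maxr.
- apply: (@le_trans _ _ (m (symdiff A B `|` symdiff A' B'))).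
    apply: prob_le; first by apply: measurable_symdiff; exact: measurableU.
      by apply: measurableU; exact: measurable_symdiff.
    move=> x [[[h|h] /not_orP[h1 h2]]|[[h|h] /not_orP[h1 h2]]].
    + by left; left.
    + by right; left.
    + by left; right.
    + by right; right.
  apply: (le_trans (prob_setU_le _ _ _)); try exact: measurable_symdiff.
  by move: hB hB'; lra.
Qed.

(** By continuity from above a finite union misses at most [e / 2] of the countable one;
    approximating the finite union costs the other half. *)
Lemma approximable_bigcup (A : (set T)^nat) :
  (forall n, approximable (A n)) -> approximable (\bigcup_n A n).
Proof.
move=> hA; have mU : measurable (\bigcup_n A n).
  by apply: bigcup_measurable => n _; have [] := hA n.
split=> // e e0; pose U n := \big[setU/set0]_(i < n) A i.
have aU n : approximable (U n).
  rewrite /U; elim: n => [|n IH].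
    rewrite big_ord0; apply: cylindric_approximable => //.
    by exists 0%N => x y _ [].
  by rewrite big_ord_recr /=; apply: approximableU.
have mUn n : measurable (U n) by have [] := aU n.
have e2 : 0 < e / 2 by rewrite divr_gt0.
have DU : \bigcap_n ((\bigcup_n A n) `\` U n) = set0.
  rewrite -subset0 => x h; have [[k _ Akx] _] := h 0%N I.
  have [_ []] := h k.+1 I; rewrite /U -bigcup_mkord.
  by exists k => /=.
have cvgD : (mu \o (fun n => (\bigcup_n A n) `\` U n)) x @[x --> \oo] --> 0%E.
  have := @nonincreasing_cvg_mu _ _ _ mu (fun n => (\bigcup_n A n) `\` U n).
  rewrite DU measure0; apply.
  - by rewrite ltey_eq fin_num_measure //; exact: measurableD.
  - by move=> n; exact: measurableD.
  - exact: measurable0.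
  - move=> n k nk; apply/subsetPset => x [Ax nU]; split=> // Ux; apply: nU.
    move: Ux; rewrite /U -!bigcup_mkord => -[i /= ik Aix]; exists i => //=.
    exact: leq_trans nk.
have [n hn] : exists n, m ((\bigcup_n A n) `\` U n) <= e / 2.
  have /fine_cvgP[_ /cvgrPdist_le /(_ _ e2)[n _ /(_ n (leqnn n)) /=]] := cvgD.
  by rewrite sub0r normrN ger0_norm ?prob_ge0 // => h; exists n.
have [B [mB cB hB]] := (aU n).2 _ e2.
exists B; split=> //.
apply: (le_trans (prob_symdiff_triangle mU (mUn n) mB)).
rewrite [X in m X + _](_ : _ = (\bigcup_n A n) `\` U n).
  by move: hn hB; lra.
rewrite /symdiff (_ : U n `\` _ = set0) ?setU0 // -subset0 => x [].
by rewrite /U -bigcup_mkord => -[i _ Aix] []; exists i.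
Qed.

Lemma sigma_algebra_approximable : sigma_algebra [set: T] approximable.
Proof.
split.
- by apply: cylindric_approximable => //; exists 0%N => x y _ [].
- by move=> A aA; rewrite setTD; exact: approximableC.
- exact: approximable_bigcup.
Qed.

Lemma approximableI (A A' : set T) :
  approximable A -> approximable A' -> approximable (A `&` A').
Proof.
move=> aA aA'; rewrite -(setCK (A `&` A')) setCI.
by apply: approximableC; apply: approximableU; apply: approximableC.
Qed.

Variables (S : set T) (mS : measurable S) (muS : mu S = 1%E).

Lemma approximable_eq_on (A A' : set T) : measurable A -> approximable A' ->
  (forall x, S x -> (A x <-> A' x)) -> approximable A.
Proof.
move=> mA [mA' hA'] AA'; split=> // e e0; have [B [mB cB hB]] := hA' _ e0.
exists B; split=> //; apply: (le_trans _ hB).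
rewrite -(prob_full mS muS) //; last exact: measurable_symdiff.
apply: prob_le; first by apply: measurableI => //; exact: measurable_symdiff.
  exact: measurable_symdiff.
move=> x [[[Ax nBx]|[Bx nAx]] Sx]; first by left; split=> //; apply/AA'.
by right; split=> // A'x; apply: nAx; exact/(AA' x Sx).
Qed.

Lemma prob_bigU_le (I : Type) (s : seq I) (A : I -> set T) :
  (forall i, measurable (A i)) ->
  m (\big[setU/set0]_(i <- s) A i) <= \sum_(i <- s) m (A i).
Proof.
move=> mA; elim: s => [|i s IH]; first by rewrite !big_nil measure0.
rewrite !big_cons; apply: (le_trans (prob_setU_le _ _ _)) => //.
  by apply: bigsetU_measurable.
by rewrite lerD2l.
Qed.

Hypothesis mg : forall n, obs (fun x => g x n).
Variables (f : T -> T).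
Hypotheses (mf : measurable_fun [set: T] f) (finv : mpreserving mu f).

(** Each fibre of [X] is replaced by a cylindric set [B a] close to it, and [X'] picks a label [a]
    with [x] in [B a]. The [B a] need neither be disjoint nor cover, but [X'] can only fail on the
    union of the symmetric differences. *)
Lemma rate_approximable (F : finType) (X : T -> F) h :
  (forall a, approximable (X @^-1` [set a])) ->
  (forall (X' : T -> F) N, obs X' ->
     (forall x y, agree N x y -> X' x = X' y) -> rate_le mu f X' h) ->
  rate_le mu f X h.
Proof.
move=> aX hX; have mX : obs X by move=> a; have [] := aX a.
apply: (rate_approx mf finv mS muS) => // e e0.
have F1 : 0 < #|F|%:R + 1 :> R by rewrite ltr_wpDl.
pose e1 := e / (#|F|%:R + 1); have e10 : 0 < e1 by rewrite divr_gt0.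
have [B hB] : {B : F -> set T & forall a, [/\ measurable (B a), cylindric (B a)
    & m (symdiff (X @^-1` [set a]) (B a)) <= e1]}.
  apply: (@choice _ _ (fun a B => [/\ measurable B, cylindric B
    & m (symdiff (X @^-1` [set a]) B) <= e1])) => a; exact: (aX a).2.
have [N hN] : {N : F -> nat & forall a x y, agree (N a) x y -> B a x -> B a y}.
  by apply: (@choice _ _ (fun a N => forall x y, agree N x y -> B a x -> B a y))
    => a; have [] := hB a.
pose a0 := X point.
(* The finite function in the test exhibits [X'] as a function of a finite observable; [a0] is a
   dummy for points outside every [B a]. *)
pose X' x := odflt a0 [pick a | [ffun a => `[< B a x >]] a].
have mX' : obs X'.
  apply: (obs_comp (fun w : {ffun F -> bool} => odflt a0 [pick a | w a])).
  apply: obs_ffun => a; apply: obs_bool; have [mB _ _] := hB a.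
  by rewrite (_ : [set x | _] = B a) //; apply/seteqP; split => x /= /asboolP.
exists X'; split=> //.
  apply: (hX _ (\max_a N a)%N) => // x y xy.
  rewrite /X'; congr (odflt _ _); apply: eq_pick => a; rewrite !ffunE.
  have le_N : (N a <= \max_a N a)%N by exact: leq_bigmax.
  apply/asboolP/asboolP; apply: hN; first exact: agree_le xy.
  by apply: agree_sym; exact: agree_le xy.
apply: (@le_trans _ _ (m (\big[setU/set0]_a symdiff (X @^-1` [set a]) (B a)))).
  apply: prob_le.
  - exact: (obs_preimage [set p | p.1 != p.2] (obs_pair mX mX')).
  - by apply: bigsetU_measurable => a _; apply: measurable_symdiff => //;
      have [] := hB a.
  move=> x /= neX; rewrite -bigcup_seq.
  (* If [x] is outside [B (X x)] the difference at [X x] contains it. Otherwise the pick succeeds,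
     and [x] is in [B (X' x)] but not in the fibre of [X' x]. *)
  have [BX|nBX] := pselect (B (X x) x); last first.
    by exists (X x); [exact: mem_index_enum|left].
  have : B (X' x) x.
    rewrite /X'; case: pickP => [a|]; rewrite ?ffunE; first by move/asboolP.
    by move=> /(_ (X x)); rewrite ffunE; move/asboolP.
  move=> BX'; exists (X' x); first exact: mem_index_enum.
  by right; split=> //= XX'; rewrite XX' eqxx in neX.
apply: (le_trans (prob_bigU_le _ _)).
  by move=> a; apply: measurable_symdiff => //; have [] := hB a.
apply: (@le_trans _ _ (e1 * #|F|%:R)).
  rewrite mulr_natr -sumr_const; apply: ler_sum => a _.
  by have [] := hB a.
by rewrite /e1 mulrAC ler_pdivrMr // ler_pM2l // lerDl.
Qed.

End Approximation.

(** * Barycentric coordinates and expansions *)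

Section Expansions.
Variables (R : realType) (beta : R).
Hypotheses (beta1 : 1 < beta) (beta32 : beta < 3 / 2).
Local Notation c := ((beta - 1)^-1).
Local Notation digit := (digit beta).
Local Notation K := (Kbeta beta).
Local Notation phi := (phi beta).
Local Notation inS := (inS beta).
Local Notation inC := (inC beta).
Local Notation inC012 := (inC012 beta).
Implicit Types (z : R * R) (b : UpsT).

Let beta0 : 0 < beta. Proof. exact: lt_trans beta1. Qed.
Let betaN0 : beta != 0. Proof. by rewrite gt_eqF. Qed.
Let c0 : 0 < c. Proof. by rewrite invr_gt0 subr_gt0. Qed.
Let cE : beta * c = 1 + c.
Proof. by field; rewrite subr_eq0 gt_eqF. Qed.

Let c2 : 2 < c.
Proof. by rewrite -[c]div1r ltr_pdivlMr ?subr_gt0 //; move: beta32; lra. Qed.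

(* Barycentric coordinates, normalised to sum to [c]; in them the three
   digits play symmetric roles. *)
Definition bary (i : 'I_3) z : R :=
  if val i == 0%N then c - z.1 - z.2 else if val i == 1%N then z.1 else z.2.

Definition heavy i z : bool := beta^-1 <= bary i z.

Lemma I3_ind (P : 'I_3 -> Prop) : P i0 -> P i1 -> P i2 -> forall i, P i.
Proof.
move=> P0 P1 P2 [[|[|[|//]]] hi].
- by have -> : Ordinal hi = i0 by exact/val_inj.
- by have -> : Ordinal hi = i1 by exact/val_inj.
- by have -> : Ordinal hi = i2 by exact/val_inj.
Qed.

Lemma inS_bary z : inS z = [forall i, 0 <= bary i z].
Proof.
apply/and3P/forallP => [[z1 z2 z12]|h]; last first.
  have := h i0; have := h i1; have := h i2; rewrite /bary /= => -> ->.
  by rewrite -addrA -opprD subr_ge0.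
by apply: I3_ind; rewrite /bary //= -addrA -opprD subr_ge0.
Qed.

Lemma bary_ge0 i z : inS z -> 0 <= bary i z.
Proof. by rewrite inS_bary => /forallP. Qed.

Lemma bary_le i z : inS z -> bary i z <= c.
Proof.
case/and3P; move: i; apply: I3_ind; rewrite /bary /=; lra.
Qed.

(** This turns the oblique boundary of the cells into the condition that coordinate 0 reaches
    [1/beta], on a par with the two others. *)
Lemma threshold : (beta * (beta - 1))^-1 = c - beta^-1.
Proof. by field; rewrite betaN0 subr_eq0 gt_eqF. Qed.

Lemma heavy0E z : heavy i0 z = ~~ ((beta * (beta - 1))^-1 < z.1 + z.2).
Proof. by rewrite threshold -leNgt /heavy /bary /=; apply/idP/idP; lra. Qed.

(** Otherwise the coordinates would add up to less than [3 / beta], but their sum is [c]. As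
    [beta * c = 1 + c], the bound [3 / beta < c] means [c > 2], that is [beta < 3/2]. *)
Lemma heavy_some z : inS z -> [|| heavy i0 z, heavy i1 z | heavy i2 z].
Proof.
move=> Sz; apply/negPn; rewrite !negb_or /heavy /bary /= -!ltNge.
apply/negP => /and3P[h0 h1 h2].
suff : 3 / beta < c by lra.
by rewrite ltr_pdivrMr // mulrC cE; have := c2; lra.
Qed.

(** The digit rule on the patterns of heavy coordinates. The pattern with none, which falls under
    the last line, is excluded on the triangle by [heavy_some]. *)
Definition select (h0 h1 h2 : bool) (o : bool) (u : 'I_3) : 'I_3 :=
  match h0, h1, h2 with
  | true, true, true => u
  | true, true, false => if o then i1 else i0
  | false, true, true => if o then i2 else i1
  | true, false, true => if o then i2 else i0
  | true, false, false => i0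
  | false, true, false => i1
  | false, false, _ => i2
  end.

Lemma cellsE z : inS z ->
  let h i := heavy i z in
  [/\ inE0 beta z = ~~ h i1 && ~~ h i2, inE1 beta z = ~~ h i2 && ~~ h i0,
      inE2 beta z = ~~ h i1 && ~~ h i0, inC01 beta z = [&& h i0, h i1 & ~~ h i2] &
  [/\ inC12 beta z = [&& ~~ h i0, h i1 & h i2],
      inC02 beta z = [&& h i0, ~~ h i1 & h i2] &
      inC012 z = [&& h i0, h i1 & h i2]]].
Proof.
move=> Sz /=; have /and3P[z1 z2 z12] := Sz.
rewrite /inE0 /inE1 /inE2 /inC01 /inC12 /inC02 /Defs.inC012 heavy0E /heavy /bary /=.
rewrite Sz z1 z2 z12 -!ltNge !negbK !leNgt /=.
by do ![case: ltP => _ //].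
Qed.

Lemma digitE x : inS x.2 -> digit x =
  select (heavy i0 x.2) (heavy i1 x.2) (heavy i2 x.2) (x.1.1 0%N) (x.1.2 0%N).
Proof.
case: x => [[om up] z] /= Sz; have [-> -> -> -> [-> -> ->]] := cellsE Sz.
by have := heavy_some Sz; do 3!case: (heavy _ _).
Qed.

Lemma inC_heavy z : inS z ->
  inC z = [|| [&& heavy i0 z, heavy i1 z & ~~ heavy i2 z],
              [&& ~~ heavy i0 z, heavy i1 z & heavy i2 z]
            | [&& heavy i0 z, ~~ heavy i1 z & heavy i2 z]].
Proof.
by move=> Sz; rewrite /Defs.inC; have [_ _ _ -> [-> -> _]] := cellsE Sz.
Qed.

Lemma inC012_heavy z : inS z ->
  inC012 z = [&& heavy i0 z, heavy i1 z & heavy i2 z].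
Proof. by move=> Sz; have [_ _ _ _ [_ _ ->]] := cellsE Sz. Qed.

(** Decodes the coin from the digit at a point of [C]: outcome 1 selects digit 1 on [C_01] and digit
    2 on the two other cells. *)
Definition bit z (a : 'I_3) : bool := if inC01 beta z then a == i1 else a == i2.

Lemma bit_digit x : inS x.2 -> inC x.2 -> bit x.2 (digit x) = x.1.1 0%N.
Proof.
move=> Sz; rewrite inC_heavy // digitE // /bit.
have [_ _ _ -> _] := cellsE Sz.
by do 3!case: (heavy _ _); case: (x.1.1 0%N).
Qed.

Lemma digit_inC012 x : inS x.2 -> inC012 x.2 -> digit x = x.1.2 0%N.
Proof.
by move=> Sz; rewrite inC012_heavy // digitE //; do 3!case: (heavy _ _).
Qed.

Lemma heavy_digit x : inS x.2 -> heavy (digit x) x.2.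
Proof.
move=> Sz; rewrite digitE //; have := heavy_some Sz.
case h0: (heavy i0 _); case h1: (heavy i1 _); case h2: (heavy i2 _) => //=;
  try by case: (x.1.1 0%N).
by move: (x.1.2 0%N); apply: I3_ind.
Qed.

(** Any heavy coordinate is a possible digit; the coins have to point to it only where they are
    actually read. *)
Lemma digit_eq x a : inS x.2 -> heavy a x.2 ->
  (inC x.2 -> x.1.1 0%N = bit x.2 a) -> (inC012 x.2 -> x.1.2 0%N = a) ->
  digit x = a.
Proof.
move=> Sz; rewrite inC_heavy // inC012_heavy // digitE // /bit.
have [_ _ _ -> _] := cellsE Sz.
case h0: (heavy i0 _); case h1: (heavy i1 _); case h2: (heavy i2 _) => //=;
  move: a; apply: I3_ind; rewrite ?h0 ?h1 ?h2 //= => _ o u; rewrite ?o ?u //.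
Qed.

Definition expand (a : 'I_3) z : R * R :=
  (beta * z.1 - (qvec R a).1, beta * z.2 - (qvec R a).2).

Lemma bary_expand i a z : bary i (expand a z) = beta * bary i z - (a == i)%:R.
Proof.
move: a i; apply: I3_ind; apply: I3_ind; rewrite /bary /expand /qvec /=;
  have := cE; lra.
Qed.

Lemma bary_inj z z' : (forall i, bary i z = bary i z') -> z = z'.
Proof.
case: z z' => [x y] [x' y'] h.
by have := h i1; have := h i2; rewrite /bary /= => -> ->.
Qed.

Lemma KbetaE (x : State R) : K x =
  (if inC x.2 then shiftB x.1.1 else x.1.1,
   if ~~ inC x.2 && inC012 x.2 then shift3 x.1.2 else x.1.2,
   expand (digit x) x.2).
Proof.
case: x => [[om up] z]; rewrite /Kbeta /expand.
by case: (Defs.inC beta z) => //; case: (Defs.inC012 beta z).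
Qed.

(** Expansion multiplies all coordinates by [beta] and lowers only the one of index [a], by 1;
    heaviness is what keeps that one nonnegative. *)
Lemma inS_expand a z : inS z -> heavy a z -> inS (expand a z).
Proof.
move=> Sz ha; rewrite inS_bary; apply/forallP => i; rewrite bary_expand.
have [<-|ai] := eqVneq a i; last by rewrite subr0 mulr_ge0 ?bary_ge0 // ltW.
by rewrite subr_ge0 mulrC -ler_pdivrMr // div1r.
Qed.

Lemma Dom_Kbeta x : Dom beta x -> Dom beta (K x).
Proof.
by rewrite /Dom /= KbetaE => Sx; apply: inS_expand => //; exact: heavy_digit.
Qed.

Lemma Dom_iter n x : Dom beta x -> Dom beta (iter n K x).
Proof. by move=> Dx; elim: n => //= n; exact: Dom_Kbeta. Qed.

(** The difference of the two solutions is multiplied by [beta] at every step, so if nonzero it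
    would grow without bound, at least linearly by Bernoulli's inequality. *)
Lemma bounded_orbit_unique (e u v : nat -> R) (M : R) :
  (forall n, `|u n| <= M) -> (forall n, `|v n| <= M) ->
  (forall n, u n.+1 = beta * u n - e n) ->
  (forall n, v n.+1 = beta * v n - e n) -> forall n, u n = v n.
Proof.
move=> uM vM ue ve n; apply/eqP/negPn/negP; rewrite -subr_eq0 => uv.
have w k : u (n + k)%N - v (n + k)%N = beta ^+ k * (u n - v n).
  elim: k => [|k IH]; first by rewrite addn0 mul1r.
  by rewrite addnS ue ve exprS -mulrA -IH; ring.
have bern k : 1 + k%:R * (beta - 1) <= beta ^+ k.
  elim: k => [|k IH]; first by rewrite mul0r addr0.
  rewrite exprS -natr1; have k0 : 0 <= k%:R :> R by [].
  have : (1 + k%:R * (beta - 1)) * beta <= beta ^+ k * beta by rewrite ler_pM2r.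
  have bm : 0 < beta - 1 by rewrite subr_gt0.
  have := mulr_ge0 k0 (sqr_ge0 (beta - 1)); rewrite expr2; nra.
have dpos : 0 < `|u n - v n| by rewrite normr_gt0.
have bm : 0 < beta - 1 by rewrite subr_gt0.
pose k := Num.bound (`|2 * M| / ((beta - 1) * `|u n - v n|)).
have : `|2 * M| / ((beta - 1) * `|u n - v n|) < k%:R.
  by apply: archi_boundP; rewrite divr_ge0 // mulr_ge0 // ltW.
rewrite ltr_pdivrMr ?mulr_gt0 // => h1.
have h2 : `|u (n + k)%N - v (n + k)%N| <= 2 * M.
  by apply: (le_trans (ler_normB _ _)); have := uM (n + k)%N;
     have := vM (n + k)%N; lra.
move: h2; rewrite w normrM ger0_norm ?exprn_ge0 ?(ltW beta0) // => h2.
have h3 : (1 + k%:R * (beta - 1)) * `|u n - v n| <= beta ^+ k * `|u n - v n|.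
  by rewrite ler_pM2r.
have := ler_norm (2 * M); lra.
Qed.

Definition psum i b n : R := \sum_(k < n) (b k == i)%:R * beta^-1 ^+ k.+1.

Definition wt i b : R := limn (psum i b).

Lemma psumS i b n : psum i b n.+1 = ((b 0%N == i)%:R + psum i (shift3 b) n) / beta.
Proof.
rewrite /psum big_ord_recl /= expr1 mulrDl; congr (_ + _).
by rewrite mulr_suml; apply: eq_bigr => k _; rewrite exprSr mulrA.
Qed.

Lemma psum_homo i b : {homo psum i b : n k / (n <= k)%N >-> n <= k}.
Proof.
apply/nondecreasing_seqP => n; rewrite /psum big_ord_recr /= lerDl mulr_ge0 //.
by rewrite exprn_ge0 // invr_ge0 ltW.
Qed.

Lemma psum_ge0 i b n : 0 <= psum i b n.
Proof. by have := psum_homo i b (leq0n n); rewrite {1}/psum big_ord0. Qed.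

Lemma psum_le i b n : psum i b n <= c.
Proof.
elim: n b => [|n IH] b; first by rewrite /psum big_ord0 ltW.
rewrite psumS ler_pdivrMr // mulrC cE lerD //.
by case: eqP.
Qed.

Lemma psum_cvg i b : psum i b x @[x --> \oo] --> wt i b.
Proof.
apply: nondecreasing_is_cvgn; first exact: psum_homo.
by exists c => _ [n _ <-]; exact: psum_le.
Qed.

Lemma wt_rec i b : wt i (shift3 b) = beta * wt i b - (b 0%N == i)%:R.
Proof.
have : wt i b = ((b 0%N == i)%:R + wt i (shift3 b)) / beta.
  apply: cvg_lim => //.
  have h := @psum_cvg i (shift3 b).
  rewrite -cvg_shiftS /=.
  rewrite (_ : (fun n => _) = fun n => ((b 0%N == i)%:R + psum i (shift3 b) n) / beta).
    by apply: cvgMr_tmp; apply: cvgD => //; exact: cvg_cst.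
  by apply/funext => n; rewrite psumS.
move=> ->; rewrite mulrC divfK //; ring.
Qed.

Lemma wt_bounds i b : 0 <= wt i b <= c.
Proof.
have h := @psum_cvg i b; have hc : cvgn (psum i b) by apply/cvg_ex; exists (wt i b).
apply/andP; split.
  by apply: limr_ge => //; apply: nearW => n; exact: psum_ge0.
by apply: limr_le => //; apply: nearW => n; exact: psum_le.
Qed.

Lemma iter_shift3 n b k : iter n shift3 b k = b (k + n)%N.
Proof. by elim: n k => [|n IH] k; rewrite ?addn0 //= /shift3 IH addSnnS. Qed.

Lemma wt_psum i b n : wt i b = psum i b n + beta^-1 ^+ n * wt i (iter n shift3 b).
Proof.
elim: n => [|n ->]; first by rewrite /psum big_ord0 mul1r add0r.
rewrite /psum big_ord_recr /= wt_rec iter_shift3 add0n -addrA; congr (_ + _).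
by rewrite !exprSr; field.
Qed.

Definition pt b : R * R := (wt i1 b, wt i2 b).

(** Along the shift orbit the sum and the constant [c] are bounded solutions of the same recursion
    [u' = beta * u - 1]. *)
Lemma sum_wt b : wt i0 b + wt i1 b + wt i2 b = c.
Proof.
pose u n := let b := iter n shift3 b in wt i0 b + wt i1 b + wt i2 b.
apply: (@bounded_orbit_unique (fun=> 1) u (fun=> c) (3 * c) _ _ _ _ 0%N).
- move=> n; have /andP[h1 h2] := wt_bounds i0 (iter n shift3 b).
  have /andP[h3 h4] := wt_bounds i1 (iter n shift3 b).
  have /andP[h5 h6] := wt_bounds i2 (iter n shift3 b).
  by rewrite /u ger0_norm; lra.
- by move=> n; rewrite ger0_norm; have := c0; lra.
- move=> n; rewrite /u /= !wt_rec.
  by move: (iter n shift3 b 0%N); apply: I3_ind => /=; lra.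
- by move=> n; have := cE; lra.
Qed.

Lemma bary_pt i b : bary i (pt b) = wt i b.
Proof.
by move: i; apply: I3_ind; rewrite /bary /pt //=; have := sum_wt b; lra.
Qed.

Lemma inS_pt b : inS (pt b).
Proof.
by rewrite inS_bary; apply/forallP => i; rewrite bary_pt; have /andP[] := wt_bounds i b.
Qed.

Lemma heavy_pt b : heavy (b 0%N) (pt b).
Proof.
rewrite /heavy bary_pt (wt_psum _ _ 1) /psum big_ord1 eqxx mul1r expr1 lerDl.
by rewrite mulr_ge0 ?invr_ge0 ?(ltW beta0) //; have /andP[] := wt_bounds (b 0%N) (iter 1 shift3 b).
Qed.

Lemma expand_pt b : expand (b 0%N) (pt b) = pt (shift3 b).
Proof. by apply: bary_inj => i; rewrite bary_expand !bary_pt wt_rec. Qed.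

Lemma phi_Kbeta x : phi (K x) = shift3 (phi x).
Proof. by apply/funext => n; rewrite /Defs.phi /shift3 -iterSr. Qed.

(** The weights along the shifted code and the coordinates along the [K]-orbit are bounded solutions
    of the same recursion. Hence the digits alone determine the position. *)
Lemma pt_phi x : Dom beta x -> pt (phi x) = x.2.
Proof.
move=> Dx; apply: bary_inj => i; rewrite bary_pt.
apply: (@bounded_orbit_unique (fun n => (phi x n == i)%:R)
  (fun n => wt i (iter n shift3 (phi x))) (fun n => bary i (iter n K x).2) c _ _ _ _ 0%N).
- by move=> n; have /andP[h1 h2] := wt_bounds i (iter n shift3 (phi x)); rewrite ger0_norm.
- move=> n; have Dn := @Dom_iter n x Dx.
  by rewrite ger0_norm ?bary_ge0 // bary_le.
- by move=> n; rewrite /= wt_rec iter_shift3.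
- by move=> n; rewrite /= [in LHS]KbetaE bary_expand.
Qed.

End Expansions.

(** * A section of the coding map *)

Section Section_of_phi.
Variables (R : realType) (beta : R).
Hypotheses (beta1 : 1 < beta) (beta32 : beta < 3 / 2).
Local Notation digit := (digit beta).
Local Notation K := (Kbeta beta).
Local Notation phi := (phi beta).
Local Notation inS := (inS beta).
Local Notation inC := (inC beta).
Local Notation inC012 := (inC012 beta).
Local Notation pt := (pt beta).
Local Notation sh n b := (iter n shift3 b).
Implicit Types (b : UpsT) (x : State R).

(** Visits are defined on codes: [pt (sh n b)] is the position at time [n] of every orbit in [Dom]
    with code [b], whatever its coins. *)
Definition visits (D : pred (R * R)) b n := D (pt (sh n b)).
Definition count_visits D b n : nat := \sum_(k < n) visits D b k.

Lemma count_visitsS D b n :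
  count_visits D b n.+1 = (count_visits D b n + visits D b n)%N.
Proof. by rewrite /count_visits big_ord_recr. Qed.

Lemma count_visits_homo D b n k :
  (n <= k)%N -> (count_visits D b n <= count_visits D b k)%N.
Proof.
move=> /subnKC <-; elim: (k - n)%N => [|j IH]; first by rewrite addn0.
by rewrite addnS count_visitsS (leq_trans IH) // leq_addr.
Qed.

Lemma count_visits_inj D b n k : visits D b n -> visits D b k ->
  count_visits D b n = count_visits D b k -> n = k.
Proof.
wlog nk : n k / (n <= k)%N => [hw vn vk e|vn _ e].
  have /orP[h|h] := leq_total n k; first exact: hw.
  by apply/esym/hw.
move: nk; rewrite leq_eqVlt => /orP[/eqP //|nk].
by have := count_visits_homo D b nk; rewrite count_visitsS vn e addn1 ltnn.
Qed.

(** The count is constant between visits, so the next visit after any time realises the count at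
    that time. For the coins this means that each of them is eventually read. *)
Lemma count_visits_onto D b :
  (forall N, exists2 n, (N <= n)%N & visits D b n) ->
  forall k, exists2 n, visits D b n & count_visits D b n = k.
Proof.
move=> io; have first_visit N : exists2 n, visits D b n &
    count_visits D b n = count_visits D b N.
  have [n0 Nn0 v0] := io N.
  have ex : exists n, (N <= n)%N && visits D b n by exists n0; rewrite Nn0.
  have [n /andP[Nn vn] hmin] := ex_minnP ex; exists n => //.
  move: hmin; rewrite -(subnKC Nn) => {vn}; move: (n - N)%N => j {n Nn}.
  elim: j => [|j IH hmin]; first by rewrite addn0.
  rewrite addnS count_visitsS IH => [|k /hmin]; last by rewrite addnS => /ltnW.
  case v: (visits D b (N + j)); rewrite ?addn0 //.
  by have := hmin (N + j)%N; rewrite leq_addr v /= addnS ltnn => /(_ isT).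
elim=> [|k [n vn <-]].
  by have [n vn e] := first_visit 0%N; exists n => //; rewrite e /count_visits big_ord0.
have [j vj e] := first_visit n.+1; exists j => //.
by rewrite e count_visitsS vn addn1.
Qed.

(** Coin number [k] is decoded at the visit to [C] preceded by [k] others; a coin that is never read
    gets [false], and in [upsilon_of] it gets [i0]. *)
Definition omega_of b : OmegaT := fun k =>
  `[< exists n, [/\ visits inC b n, count_visits inC b n = k &
                    bit beta (pt (sh n b)) (b n)] >].

Definition upsilon_digit b k a : Prop :=
  exists n, [/\ visits inC012 b n, count_visits inC012 b n = k & b n = a].

Definition upsilon_of b : UpsT := fun k =>
  if `[< upsilon_digit b k i1 >] then i1
  else if `[< upsilon_digit b k i2 >] then i2 else i0.

Definition psi b : State R := (omega_of b, upsilon_of b, pt b).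

Lemma omega_of_visit b n : visits inC b n ->
  omega_of b (count_visits inC b n) = bit beta (pt (sh n b)) (b n).
Proof.
move=> vn; apply/asboolP/idP => [[k [vk e h]]|h]; last by exists n.
by rewrite (count_visits_inj vn vk).
Qed.

Lemma upsilon_digit_visit b n a : visits inC012 b n ->
  upsilon_digit b (count_visits inC012 b n) a <-> b n = a.
Proof.
move=> vn; split=> [[k [vk e <-]]|<-]; last by exists n.
by rewrite (count_visits_inj vn vk).
Qed.

Lemma upsilon_of_visit b n : visits inC012 b n ->
  upsilon_of b (count_visits inC012 b n) = b n.
Proof.
move=> vn; rewrite /upsilon_of.
case: asboolP => [/(upsilon_digit_visit _ vn) -> //|n1].
case: asboolP => [/(upsilon_digit_visit _ vn) -> //|n2].
move: n1 n2; rewrite !upsilon_digit_visit //.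
by move: (b n); apply: I3_ind.
Qed.

(** The expected state at time [n] of the orbit starting from the coins [om], [up] with code [b]:
    each visit has consumed one coin of its kind. *)
Definition shifted (om : OmegaT) (up : UpsT) b n : State R :=
  (fun j => om (j + count_visits inC b n)%N,
   fun j => up (j + count_visits inC012 b n)%N, pt (sh n b)).

Lemma Kbeta_shifted om up b n : digit (shifted om up b n) = b n ->
  K (shifted om up b n) = shifted om up b n.+1.
Proof.
rewrite KbetaE => ->; rewrite /shifted !count_visitsS /= /visits.
have Sz := inS_pt beta1 (sh n b).
rewrite -[b n](iter_shift3 n b 0) expand_pt //; congr (_, _, _).
  by apply/funext => j; rewrite /shiftB; case: ifP => _; rewrite ?addn0 // addn1 addSnnS.
apply/funext => j; rewrite /shift3.
(* [C] and [C_012] are disjoint, so a visit to [C_012] always consumes a coin of [up]. *)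
have -> : ~~ inC (pt (sh n b)) && inC012 (pt (sh n b)) = inC012 (pt (sh n b)).
  rewrite inC_heavy // inC012_heavy //.
  by do 3!case: (heavy _ _ _).
by case: ifP => _; rewrite ?addn0 // addn1 addSnnS.
Qed.

Lemma digit_shifted_psi b n :
  digit (shifted (omega_of b) (upsilon_of b) b n) = b n.
Proof.
apply: digit_eq => //=.
- exact: inS_pt.
- by rewrite -[b n](iter_shift3 n b 0); exact: heavy_pt.
- by move=> v; rewrite add0n omega_of_visit.
- by move=> v; rewrite add0n upsilon_of_visit.
Qed.

Lemma shifted0 om up b : shifted om up b 0 = (om, up, pt b).
Proof.
by rewrite /shifted /count_visits !big_ord0; congr (_, _, _);
  apply/funext => j; rewrite addn0.
Qed.

Lemma iter_psi b n : iter n K (psi b) = shifted (omega_of b) (upsilon_of b) b n.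
Proof.
elim: n => [|n IH]; first by rewrite shifted0.
by rewrite iterS IH Kbeta_shifted // digit_shifted_psi.
Qed.

(** This holds for every code, since the default coins of [psi b] are never read along its orbit. *)
Lemma psiK b : phi (psi b) = b.
Proof. by apply/funext => n; rewrite /Defs.phi iter_psi digit_shifted_psi. Qed.

Lemma Dom_psi b : Dom beta (psi b).
Proof. exact: inS_pt. Qed.

Lemma iter_Dom x n : Dom beta x ->
  iter n K x = shifted x.1.1 x.1.2 (phi x) n.
Proof.
move=> Dx; elim: n => [|n IH].
  by rewrite shifted0 pt_phi //; case: x {Dx} => [[]].
by rewrite iterS IH Kbeta_shifted // -IH.
Qed.

Definition Zcode : set UpsT := [set b |
  (forall N, exists2 n, (N <= n)%N & visits inC b n) /\
  (forall N, exists2 n, (N <= n)%N & visits inC012 b n)].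

Lemma Zset_phi x : Dom beta x -> Zset beta x <-> Zcode (phi x).
Proof.
move=> Dx; have e n : (iter n K x).2 = pt (sh n (phi x)) by rewrite iter_Dom.
split=> [[_ [h1 h2]]|[h1 h2]].
  by split=> N; [have [n Nn] := h1 N|have [n Nn] := h2 N]; rewrite e; exists n.
split=> //; split=> N; [have [n Nn] := h1 N|have [n Nn] := h2 N];
  by rewrite /visits -e; exists n.
Qed.

Lemma Zset_psi b : Zset beta (psi b) <-> Zcode b.
Proof. by rewrite (Zset_phi (Dom_psi b)) psiK. Qed.

(** The position is determined by the code. On [Z] each coin of [x] is read at some visit, where the
    digit reveals it. *)
Lemma phiK x : Zset beta x -> psi (phi x) = x.
Proof.
move=> Zx; have Dx : Dom beta x by case: Zx.
have [io1 io2] : Zcode (phi x) by apply/Zset_phi.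
have dE n : phi x n = digit (shifted x.1.1 x.1.2 (phi x) n) by rewrite -iter_Dom.
rewrite [RHS](_ : x = (x.1.1, x.1.2, x.2)); last by case: x {Zx Dx io1 io2 dE} => [[]].
rewrite /psi pt_phi //; congr (_, _, _); apply/funext => k.
  have [n v <-] := count_visits_onto io1 k; rewrite omega_of_visit // [phi x n]dE.
  have := bit_digit beta1 beta32 (x := shifted x.1.1 x.1.2 (phi x) n).
  by rewrite /= add0n; apply => //; exact: inS_pt.
have [n v <-] := count_visits_onto io2 k; rewrite upsilon_of_visit // [phi x n]dE.
have := digit_inC012 beta1 beta32 (x := shifted x.1.1 x.1.2 (phi x) n).
by rewrite /= add0n; apply => //; exact: inS_pt.
Qed.

(** Turning an image under [phi] into a preimage under [psi] yields both the measurability of the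
    image and the additivity of its measure in [A]. *)
Lemma phi_image (A : set (State R)) :
  phi @` (Zset beta `&` A) = Zcode `&` psi @^-1` A.
Proof.
apply/seteqP; split=> [_ [x [Zx Ax] <-]|b [Zb Ab]] /=.
  by rewrite phiK //; split=> //; apply/Zset_phi => //; case: Zx.
by exists (psi b); [split=> //; apply/Zset_psi|exact: psiK].
Qed.

(** Both sides have code [shift3 b], and [phi] is injective on [Z], which contains [K (psi b)]. *)
Lemma psi_shift b : Zcode b -> psi (shift3 b) = K (psi b).
Proof.
move=> [io1 io2]; rewrite -{1}[b]psiK -phi_Kbeta phiK //.
split; first exact/Dom_Kbeta/Dom_psi.
have e n : (iter n K (K (psi b))).2 = pt (sh n.+1 b).
  by rewrite -iterSr iter_psi.
split=> N; [have [[|n] // Nn v] := io1 N.+1|have [[|n] // Nn v] := io2 N.+1];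
  by exists n; rewrite // e.
Qed.

End Section_of_phi.

(** * Measurability *)

Section Measurability.
Variables (R : realType).

Lemma obs_ups n : obs (fun b : Ups => b n).
Proof.
move=> a; rewrite (_ : _ @^-1` _ =
  \bigcup_(w in [set w : n.+1.-tuple 'I_3 | tnth w ord_max = a]) cyl3 w).
  apply: fin_bigcup_measurable => [|w _]; first exact: finite_finset.
  by apply: sub_sigma_algebra; exists n.+1, w.
apply/seteqP; split=> [b /= ba|b /= [w <- h]]; last exact: (h ord_max).
exists [tuple b i | i < n.+1]; first by rewrite /= tnth_mktuple.
by move=> i; rewrite tnth_mktuple.
Qed.

Lemma measurable_to_ups d (T : measurableType d) (h : T -> Ups) :
  (forall n, obs (fun t => h t n)) -> measurable_fun [set: T] h.
Proof.
move=> mh; apply: (@measurability _ _ T Ups setT h Ups_gen erefl) => // _ [_ [n [w ->]] <-].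
rewrite setTI (_ : _ @^-1` _ =
  \bigcap_(i in [set: 'I_n]) (fun t => h t i) @^-1` [set tnth w i]).
  apply: fin_bigcap_measurable => [|i _]; first exact: finite_finset.
  exact: mh.
by apply/seteqP; split=> [t ht i _|t ht i]; [exact: ht|exact: (ht i I)].
Qed.

Lemma measurable_state_box n (u : n.-tuple bool) k (w : k.-tuple 'I_3)
    (a1 b1 a2 b2 : R) :
  measurable [set x : State R | cylB u x.1.1 /\ cyl3 w x.1.2 /\
    a1 < x.2.1 < b1 /\ a2 < x.2.2 < b2].
Proof. by apply: sub_sigma_algebra; exists n, u, k, w, a1, b1, a2, b2. Qed.

(** The generating boxes are bounded in the plane, so sets that leave a coordinate free are
    exhausted by countably many boxes of size [k]. *)
Lemma real_in_ball (a b : R) : exists k : nat, - k%:R < a < k%:R /\ - k%:R < b < k%:R.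
Proof.
exists (Num.bound (`|a| + `|b|)); rewrite -!ltr_norml.
have := @archi_boundP R (`|a| + `|b|) (addr_ge0 (normr_ge0 a) (normr_ge0 b)).
by have := normr_ge0 a; have := normr_ge0 b; split; lra.
Qed.

Lemma measurable_state_cyl n (u : n.-tuple bool) k (w : k.-tuple 'I_3) :
  measurable [set x : State R | cylB u x.1.1 /\ cyl3 w x.1.2].
Proof.
rewrite (_ : [set _ | _] = \bigcup_(j : nat) [set x : State R | cylB u x.1.1 /\
    cyl3 w x.1.2 /\ - j%:R < x.2.1 < j%:R /\ - j%:R < x.2.2 < j%:R]).
  by apply: bigcup_measurable => j _; exact: measurable_state_box.
apply/seteqP; split=> [x /= [h1 h2]|x /= [j _ [h1 [h2 _]]] //].
by have [j hj] := real_in_ball x.2.1 x.2.2; exists j.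
Qed.

Lemma obs_state_om n : obs (fun x : State R => x.1.1 n).
Proof.
move=> a; rewrite (_ : _ @^-1` _ =
  \bigcup_(w in [set w : n.+1.-tuple bool | tnth w ord_max = a])
    [set x : State R | cylB w x.1.1 /\ cyl3 [tuple] x.1.2]).
  apply: fin_bigcup_measurable => [|w _]; first exact: finite_finset.
  exact: measurable_state_cyl.
apply/seteqP; split=> [x /= xa|x /= [w <- [h _]]]; last exact: (h ord_max).
exists [tuple x.1.1 i | i < n.+1]; first by rewrite /= tnth_mktuple.
by split=> [i|[]//]; rewrite tnth_mktuple.
Qed.

Lemma obs_state_up n : obs (fun x : State R => x.1.2 n).
Proof.
move=> a; rewrite (_ : _ @^-1` _ =
  \bigcup_(w in [set w : n.+1.-tuple 'I_3 | tnth w ord_max = a])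
    [set x : State R | cylB [tuple] x.1.1 /\ cyl3 w x.1.2]).
  apply: fin_bigcup_measurable => [|w _]; first exact: finite_finset.
  exact: measurable_state_cyl.
apply/seteqP; split=> [x /= xa|x /= [w <- [_ h]]]; last exact: (h ord_max).
exists [tuple x.1.2 i | i < n.+1]; first by rewrite /= tnth_mktuple.
by split=> [[]//|i]; rewrite tnth_mktuple.
Qed.

Lemma measurable_state_fst : measurable_fun [set: State R] (fun x => x.2.1).
Proof.
apply: (measurability _ (RGenOInfty.measurableE R)) => // _ [_ [a ->] <-].
rewrite setTI (_ : _ @^-1` _ = \bigcup_(j : nat) [set x : State R |
    cylB [tuple] x.1.1 /\ cyl3 [tuple] x.1.2 /\
    a < x.2.1 < j%:R /\ - j%:R < x.2.2 < j%:R]).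
  by apply: bigcup_measurable => j _; exact: measurable_state_box.
apply/seteqP; split=> [x /=|x /= [j _ [_ [_ [/andP[h _] _]]]]]; rewrite in_itv /= andbT //.
move=> ax; have [j [/andP[_ h1] h2]] := real_in_ball x.2.1 x.2.2.
by exists j => //; split=> [[]//|]; split=> [[]//|]; rewrite ax h1.
Qed.

Lemma measurable_state_snd : measurable_fun [set: State R] (fun x => x.2.2).
Proof.
apply: (measurability _ (RGenOInfty.measurableE R)) => // _ [_ [a ->] <-].
rewrite setTI (_ : _ @^-1` _ = \bigcup_(j : nat) [set x : State R |
    cylB [tuple] x.1.1 /\ cyl3 [tuple] x.1.2 /\
    - j%:R < x.2.1 < j%:R /\ a < x.2.2 < j%:R]).
  by apply: bigcup_measurable => j _; exact: measurable_state_box.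
apply/seteqP; split=> [x /=|x /= [j _ [_ [_ [_ /andP[h _]]]]]]; rewrite in_itv /= andbT //.
move=> ax; have [j [h2 /andP[_ h1]]] := real_in_ball x.2.1 x.2.2.
by exists j => //; split=> [[]//|]; split=> [[]//|]; rewrite ax h1.
Qed.

Lemma measurable_to_state d (T : measurableType d) (h : T -> State R) :
  (forall n, obs (fun t => (h t).1.1 n)) -> (forall n, obs (fun t => (h t).1.2 n)) ->
  measurable_fun [set: T] (fun t => (h t).2.1) ->
  measurable_fun [set: T] (fun t => (h t).2.2) ->
  measurable_fun [set: T] h.
Proof.
move=> mo mu m1 m2; apply: (@measurability _ _ T (State R) setT h (@State_gen R) erefl) => //.
move=> _ [_ [n [u [k [w [a1 [b1 [a2 [b2 ->]]]]]]]] <-].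
rewrite setTI (_ : _ @^-1` _ =
  (\bigcap_(i in [set: 'I_n]) (fun t => (h t).1.1 i) @^-1` [set tnth u i]) `&`
  (\bigcap_(i in [set: 'I_k]) (fun t => (h t).1.2 i) @^-1` [set tnth w i]) `&`
  ((fun t => (h t).2.1) @^-1` `]a1, b1[ `&` (fun t => (h t).2.2) @^-1` `]a2, b2[)).
  apply: measurableI; apply: measurableI.
  - by apply: fin_bigcap_measurable => [|i _]; [exact: finite_finset|exact: mo].
  - by apply: fin_bigcap_measurable => [|i _]; [exact: finite_finset|exact: mu].
  - by rewrite -[X in measurable X]setTI; apply: m1 => //; exact: measurable_itv.
  - by rewrite -[X in measurable X]setTI; apply: m2 => //; exact: measurable_itv.
apply/seteqP; split=> [t /= [h1 [h2 [h3 h4]]]|t /= [[h1 h2]]].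
  by rewrite !in_itv /=; split=> //; split=> i _ /=; [exact: h1|exact: h2].
rewrite !in_itv /= => -[h3 h4]; split; first by move=> i; exact: (h1 i I).
by split=> // i; exact: (h2 i I).
Qed.

Variable beta : R.

Section Cells.
Context {d : measure_display} {T : measurableType d}.
Variable z : T -> R * R.
Hypotheses (mz1 : measurable_fun [set: T] (fun t => (z t).1))
           (mz2 : measurable_fun [set: T] (fun t => (z t).2)).

Lemma obs_le (f g : T -> R) : measurable_fun [set: T] f ->
  measurable_fun [set: T] g -> obs (fun t => f t <= g t).
Proof.
move=> mf mg; apply: obs_bool; rewrite -[X in measurable X]setTI.
exact: measurable_fun_le.
Qed.

Lemma measurable_bary i : measurable_fun [set: T] (fun t => bary beta i (z t)).
Proof.
move: i; apply: I3_ind; rewrite /bary //=.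
apply: (@measurable_funB _ _ _ _ (fun t => _ - (z t).1) (fun t => (z t).2)) => //.
exact: (@measurable_funB _ _ _ _ (fun=> _) (fun t => (z t).1)).
Qed.

Lemma obs_heavy i : obs (fun t => heavy beta i (z t)).
Proof. by apply: obs_le => //; exact: measurable_bary. Qed.

Lemma obs_inS : obs (fun t => inS beta (z t)).
Proof.
under eq_fun do rewrite inS_bary.
rewrite (_ : (fun t => _) =
  fun t => [forall i, [ffun i => 0 <= bary beta i (z t)] i]); last first.
  by apply/funext => t; apply/eq_forallb => i; rewrite ffunE.
apply: (obs_comp (fun w : {ffun 'I_3 -> bool} => [forall i, w i])).
by apply: obs_ffun => i; apply: obs_le => //; exact: measurable_bary.
Qed.

(** A single finite observable from which all tests on the position are computed. The flag [inS] is
    kept because the cells are described by heavy coordinates only inside the triangle. *)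
Definition cells (t : T) : {ffun 'I_3 -> bool} * bool :=
  ([ffun i => heavy beta i (z t)], inS beta (z t)).

Lemma obs_cells : obs cells.
Proof.
apply: obs_pair; last exact: obs_inS.
by apply: obs_ffun => i; exact: obs_heavy.
Qed.

Hypotheses (beta1 : 1 < beta) (beta32 : beta < 3 / 2).

Lemma obs_inC : obs (fun t => inC beta (z t)).
Proof.
rewrite (_ : (fun t => _) = fun t => let p := cells t in p.2 &&
   [|| [&& p.1 i0, p.1 i1 & ~~ p.1 i2], [&& ~~ p.1 i0, p.1 i1 & p.1 i2]
     | [&& p.1 i0, ~~ p.1 i1 & p.1 i2]]).
  exact: (obs_comp (fun p : {ffun 'I_3 -> bool} * bool => p.2 &&
    [|| [&& p.1 i0, p.1 i1 & ~~ p.1 i2], [&& ~~ p.1 i0, p.1 i1 & p.1 i2]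
      | [&& p.1 i0, ~~ p.1 i1 & p.1 i2]]) obs_cells).
apply/funext => t; rewrite /= !ffunE; case: (boolP (inS beta (z t))) => Sz.
  by rewrite inC_heavy.
by rewrite /inC /inC01 /inC12 /inC02 (negbTE Sz).
Qed.

Lemma obs_inC012 : obs (fun t => inC012 beta (z t)).
Proof.
rewrite (_ : (fun t => _) = fun t => let p := cells t in p.2 &&
   [&& p.1 i0, p.1 i1 & p.1 i2]).
  exact: (obs_comp (fun p : {ffun 'I_3 -> bool} * bool => p.2 &&
    [&& p.1 i0, p.1 i1 & p.1 i2]) obs_cells).
apply/funext => t; rewrite /= !ffunE; case: (boolP (inS beta (z t))) => Sz.
  by rewrite inC012_heavy.
by rewrite /inC012 (negbTE Sz).
Qed.

End Cells.

Hypotheses (beta1 : 1 < beta) (beta32 : beta < 3 / 2).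

Lemma measurable_Dom : measurable (Dom beta : set (State R)).
Proof.
exact: (obs_inS measurable_state_fst measurable_state_snd true).
Qed.

Lemma obs_digit : obs (digit beta : State R -> 'I_3).
Proof.
pose p (x : State R) := (cells (fun x : State R => x.2) x, x.1.1 0%N, x.1.2 0%N).
have mp : obs p.
  apply: obs_pair; last exact: obs_state_up.
  apply: obs_pair; last exact: obs_state_om.
  exact: (obs_cells measurable_state_fst measurable_state_snd).
rewrite (_ : digit beta = fun x => let q := p x in if q.1.1.2 then
  select (q.1.1.1 i0) (q.1.1.1 i1) (q.1.1.1 i2) q.1.2 q.2 else i0).
  exact: (obs_comp (fun q : {ffun 'I_3 -> bool} * bool * bool * 'I_3 => if q.1.1.2 then
  select (q.1.1.1 i0) (q.1.1.1 i1) (q.1.1.1 i2) q.1.2 q.2 else i0) mp).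
apply/funext => x; rewrite /p /= !ffunE.
case: (boolP (inS beta x.2)) => Sx; first by rewrite digitE.
case: x Sx => [[om up] z] /= /negbTE Sz.
by rewrite /inE0 /inE1 /inE2 /inC01 /inC12 /inC02 /inC012 Sz.
Qed.

Lemma measurable_Kbeta : measurable_fun [set: State R] (Kbeta beta).
Proof.
have mC := obs_inC measurable_state_fst measurable_state_snd beta1.
have mD := obs_inC012 measurable_state_fst measurable_state_snd beta1.
apply: measurable_to_state.
- move=> n; under eq_fun do rewrite KbetaE.
  rewrite (_ : (fun t => _) = fun t : State R =>
    if inC beta t.2 then t.1.1 n.+1 else t.1.1 n).
    exact: (obs_comp (fun p : bool * (bool * bool) => if p.1 then p.2.1 else p.2.2)
      (obs_pair mC (obs_pair (obs_state_om n.+1) (obs_state_om n)))).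
  by apply/funext => t /=; case: ifP.
- move=> n; under eq_fun do rewrite KbetaE.
  rewrite (_ : (fun t => _) = fun t : State R =>
    if ~~ inC beta t.2 && inC012 beta t.2 then t.1.2 n.+1 else t.1.2 n).
    exact: (obs_comp (fun p : (bool * bool) * ('I_3 * 'I_3) =>
       if ~~ p.1.1 && p.1.2 then p.2.1 else p.2.2)
      (obs_pair (obs_pair mC mD) (obs_pair (obs_state_up n.+1) (obs_state_up n)))).
  by apply/funext => t /=; case: ifP.
- under eq_fun do rewrite KbetaE /=.
  apply: (@measurable_funB _ _ _ _ (fun x : State R => beta * x.2.1)).
    apply: (@measurable_funM _ _ _ _ (fun=> beta)) => //.
    exact: measurable_state_fst.
  move=> _ U mU; rewrite setTI.
  exact: (obs_preimage [set a | U (qvec R a).1] obs_digit).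
- under eq_fun do rewrite KbetaE /=.
  apply: (@measurable_funB _ _ _ _ (fun x : State R => beta * x.2.2)).
    apply: (@measurable_funM _ _ _ _ (fun=> beta)) => //.
    exact: measurable_state_snd.
  move=> _ U mU; rewrite setTI.
  exact: (obs_preimage [set a | U (qvec R a).2] obs_digit).
Qed.

Lemma measurable_phi : measurable_fun [set: State R] (phi beta : State R -> Ups).
Proof.
apply: measurable_to_ups => n.
exact: (obs_iter measurable_Kbeta n obs_digit).
Qed.

Lemma obs_shift3 n k : obs (fun b : Ups => iter n shift3 b k).
Proof. by under eq_fun do rewrite iter_shift3; exact: obs_ups. Qed.

Lemma measurable_shift3 n :
  measurable_fun [set: Ups] (iter n shift3 : Ups -> Ups).
Proof. by apply: measurable_to_ups => k; exact: obs_shift3. Qed.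

(** A weight is the pointwise limit of its partial sums, which depend on finitely many digits. *)
Lemma measurable_wt i n :
  measurable_fun [set: Ups] (fun b : Ups => wt beta i (iter n shift3 b)).
Proof.
apply: (@measurable_fun_cvg _ _ _ [set: Ups]
  (fun k (b : Ups) => psum beta i (iter n shift3 b) k)).
  move=> k _ U mU; rewrite setTI.
  have := obs_preimage [set w : {ffun 'I_k -> 'I_3} |
    U (\sum_(j < k) (w j == i)%:R * beta^-1 ^+ j.+1)]
    (obs_ffun (fun j : 'I_k => obs_shift3 n j)).
  congr measurable; apply/seteqP; split=> b /=; rewrite /psum;
    by under eq_bigr do rewrite ffunE.
by move=> b _; exact: psum_cvg.
Qed.

Lemma obs_visits_inC n : obs (fun b : Ups => visits beta (inC beta) b n).
Proof. by apply: obs_inC => //; exact: measurable_wt. Qed.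

Lemma obs_visits_inC012 n : obs (fun b : Ups => visits beta (inC012 beta) b n).
Proof. by apply: obs_inC012 => //; exact: measurable_wt. Qed.

Lemma measurable_count_visits (D : pred (R * R)) n k :
  (forall n, obs (fun b : Ups => visits beta D b n)) ->
  measurable [set b : Ups | count_visits beta D b n = k].
Proof.
move=> mD; have := obs_preimage [set w : {ffun 'I_n -> bool} |
    (\sum_(j < n) w j)%N = k] (obs_ffun (fun j : 'I_n => mD j)).
congr measurable; apply/seteqP; split=> b /=; rewrite /count_visits;
  by under eq_bigr do rewrite ffunE.
Qed.

Lemma obs_bit n : obs (fun b : Ups => bit beta (pt beta (iter n shift3 b)) (b n)).
Proof.
have mcell := obs_cells (z := fun b : Ups => pt beta (iter n shift3 b))
  (measurable_wt i1 n) (measurable_wt i2 n).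
rewrite (_ : (fun b => _) = fun b : Ups =>
  let p := (cells (fun b : Ups => pt beta (iter n shift3 b)) b, b n) in
  if [&& p.1.1 i0, p.1.1 i1 & ~~ p.1.1 i2] then p.2 == i1 else p.2 == i2).
  exact: (obs_comp (fun p : ({ffun 'I_3 -> bool} * bool) * 'I_3 =>
   if [&& p.1.1 i0, p.1.1 i1 & ~~ p.1.1 i2] then p.2 == i1 else p.2 == i2)
   (obs_pair mcell (obs_ups n))).
apply/funext => b /=; rewrite !ffunE /bit.
by have [_ _ _ -> _] := cellsE beta1 (inS_pt beta1 (iter n shift3 b)).
Qed.

Lemma measurable_psi : measurable_fun [set: Ups] (psi beta : Ups -> State R).
Proof.
apply: measurable_to_state.
- move=> k; apply: obs_bool.
  rewrite (_ : [set _ | _] = \bigcup_(n : nat)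
    ([set b | visits beta (inC beta) b n] `&`
     [set b | count_visits beta (inC beta) b n = k] `&`
     [set b | bit beta (pt beta (iter n shift3 b)) (b n)])).
    apply: bigcup_measurable => n _; apply: measurableI; last exact: (obs_bit n true).
    apply: measurableI; first exact: (obs_visits_inC n true).
    by apply: measurable_count_visits => j; exact: obs_visits_inC.
  apply/seteqP; split=> b /=.
    by move=> /asboolP[n [h1 h2 h3]]; exists n.
  by move=> [n _ [[h1 h2] h3]]; apply/asboolP; exists n.
- move=> k; pose p a (b : Ups) := `[< upsilon_digit beta b k a >].
  have mp a : obs (p a).
    apply: obs_bool; rewrite (_ : [set _ | _] = \bigcup_(n : nat)
      ([set b | visits beta (inC012 beta) b n] `&`
       [set b | count_visits beta (inC012 beta) b n = k] `&`
       (fun b : Ups => b n) @^-1` [set a])).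
      apply: bigcup_measurable => n _; apply: measurableI; last exact: obs_ups.
      apply: measurableI; first exact: (obs_visits_inC012 n true).
      by apply: measurable_count_visits => j; exact: obs_visits_inC012.
    apply/seteqP; split=> b /=.
      by move=> /asboolP[n [h1 h2 h3]]; exists n.
    by move=> [n _ [[h1 h2] h3]]; apply/asboolP; exists n.
  exact: (obs_comp (fun q : bool * bool => if q.1 then i1 else if q.2 then i2 else i0)
    (obs_pair (mp i1) (mp i2))).
- exact: (measurable_wt i1 0).
- exact: (measurable_wt i2 0).
Qed.

Lemma measurable_io (D : pred (R * R)) :
  (forall n, obs (fun b : Ups => visits beta D b n)) ->
  measurable [set b : Ups | forall N, exists2 n, (N <= n)%N & visits beta D b n].
Proof.
move=> mD; rewrite (_ : [set _ | _] =
  \bigcap_N \bigcup_(n in [set n | (N <= n)%N]) [set b : Ups | visits beta D b n]).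
  apply: bigcap_measurable => [|N _]; first by exists 0%N.
  by apply: bigcup_measurable => n _; exact: (mD n true).
apply/seteqP; split=> b /= h N; first by move=> _; have [n] := h N; exists n.
by have [n] := h N I; exists n.
Qed.

Lemma measurable_Zcode : measurable (Zcode beta : set Ups).
Proof.
by apply: measurableI; apply: measurable_io => n;
  [exact: obs_visits_inC|exact: obs_visits_inC012].
Qed.

End Measurability.

(** * The uniform measure on codes *)

Section CodeMeasure.
Variables (R : realType).

(** Two cylinders are nested or disjoint; the empty set is adjoined for the second case, not being a
    cylinder. *)
Lemma setI_closed_cyl : setI_closed (Ups_gen `|` [set set0]).
Proof.
have key n (w : n.-tuple 'I_3) k (v : k.-tuple 'I_3) : (n <= k)%N ->
    (Ups_gen `|` [set set0]) (cyl3 w `&` cyl3 v).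
  move=> nk; have [[b [bw bv]]|h] := pselect (cyl3 w `&` cyl3 v !=set0).
    left; exists k, v; apply/seteqP; split=> [x []//|x xv]; split=> // i.
    by have := xv (widen_ord nk i); rewrite /= => ->; rewrite -bv -bw.
  by right; apply/eqP/negP => /negP/set0P.
move=> A B [[n [w ->]]|->]; last by rewrite set0I; right.
move=> [[k [v ->]]|->]; last by rewrite setI0; right.
have /orP[nk|kn] := leq_total n k; first exact: key.
by rewrite setIC; exact: key.
Qed.

Lemma ups_measure_ext (m1 m2 : {measure set Ups -> \bar R}) :
  (forall n (w : n.-tuple 'I_3), m1 (cyl3 w) = m2 (cyl3 w)) ->
  (m1 [set: Ups] < +oo)%E -> forall A : set Ups, measurable A -> m1 A = m2 A.
Proof.
move=> m12 fin A mA.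
have cylT : cyl3 [tuple] = setT by apply/seteqP; split=> // b _ [].
apply: (@g_sigma_algebra_measure_unique _ R Ups (Ups_gen `|` [set set0]) _
  (fun=> setT) _ _ m1 m2 _ _ _ A).
- by move=> B [BG|->]; [exact: sub_sigma_algebra|exact: measurable0].
- by move=> _; left; exists 0%N, [tuple]; rewrite cylT.
- by apply/seteqP; split=> // b _; exists 0%N.
- exact: setI_closed_cyl.
- by move=> _ [[n [w ->]]|->]; rewrite ?measure0.
- by move=> _.
- by apply: sub_sigma_algebra2 mA => B BG; left.
Qed.

Definition prefix_set (l : nat) (w : nat -> 'I_3) : set Ups :=
  [set b | forall i, (i < l)%N -> b i = w i].

Lemma prefix_set_cyl l w : prefix_set l w = cyl3 [tuple w i | i < l].
Proof.
apply/seteqP; split=> b h i; first by rewrite tnth_mktuple h.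
by move=> il; have := h (Ordinal il); rewrite tnth_mktuple.
Qed.

Lemma measurable_prefix_set l w : measurable (prefix_set l w).
Proof. by rewrite prefix_set_cyl; apply: sub_sigma_algebra; exists l, [tuple w i | i < l]. Qed.

Variable P : probability Ups R.
Hypothesis hP : forall (n : nat) (w : n.-tuple 'I_3), P (cyl3 w) = (3%:R ^- n)%:E.
Local Notation sh n b := (iter n shift3 b).

Lemma measurable_preshift n (A : set Ups) : measurable A ->
  measurable ((iter n shift3 : Ups -> Ups) @^-1` A).
Proof.
by move=> mA; rewrite -[X in measurable X]setTI; exact: measurable_shift3.
Qed.

(** Independence of the first [l] digits from the rest: as functions of [A] both sides are finite
    measures, and they agree on cylinders, where the two words are concatenated. *)
Lemma prob_prefix_shift l w (A : set Ups) : measurable A ->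
  P (prefix_set l w `&` (iter l shift3 : Ups -> Ups) @^-1` A) =
  ((3%:R ^- l)%:E * P A)%E.
Proof.
move=> mA; have mp := measurable_prefix_set l w.
have r0 : 0 <= 3%:R ^- l :> R by rewrite invr_ge0 exprn_ge0.
pose m1 := measure_function_pushforward__canonical__measure_function_Measure
  (mrestr P mp) (@measurable_shift3 l).
pose m2 := mscale (NngNum r0) P.
rewrite setIC; apply: (@ups_measure_ext m1 m2 _ _ A mA).
  move=> n v; rewrite /m1 /m2 /= /pushforward /mrestr /mscale /= hP.
  pose u i := if (i < l)%N then w i else nth i0 v (i - l).
  have -> : (iter l shift3 : Ups -> Ups) @^-1` cyl3 v `&` prefix_set l w =
      cyl3 [tuple u i | i < l + n].
    rewrite -prefix_set_cyl; apply/seteqP; split=> b /=.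
      move=> [h1 h2] i iln; rewrite /u; case: ltnP => il; first exact: h2.
      have iln' : (i - l < n)%N by lia.
      by have := h1 (Ordinal iln'); rewrite iter_shift3 /= subnK // (tnth_nth i0).
    move=> h; split=> i.
      rewrite iter_shift3 h; last by have := ltn_ord i; lia.
      by rewrite /u ltnNge leq_addl /= addnK (tnth_nth i0).
    by move=> il; rewrite h; [rewrite /u il|lia].
  by rewrite hP -EFinM exprD invfM.
rewrite /m1 /= /pushforward /mrestr /=.
by rewrite preimage_setT setTI ltey_eq fin_num_measure.
Qed.

(** Split by the first digit: each of the three values contributes a third of [P A]. *)
Lemma prob_shift (A : set Ups) : measurable A -> P (shift3 @^-1` A) = P A.
Proof.
move=> mA; have mS : measurable ((shift3 : Ups -> Ups) @^-1` A).
  exact: (measurable_preshift 1 mA).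
rewrite -[LHS]fineK ?fin_num_measure // -[RHS]fineK ?fin_num_measure //.
congr (_%:E).
rewrite (prob_sum_obs P (@obs_ups 0%N)) //.
rewrite (eq_bigr (fun=> 3^-1 * fine (P A))).
  by rewrite sumr_const card_ord; field.
move=> a _; have := @prob_prefix_shift 1 (fun=> a) A mA.
rewrite expr1 => h; rewrite -[RHS]/(fine ((3^-1 * fine (P A))%:E)) EFinM.
rewrite fineK ?fin_num_measure // -h setIC; congr (fine (P (_ `&` _))).
by apply/seteqP; split=> b /=; [move=> <- [|//]|move=> /(_ 0%N isT)].
Qed.

Lemma prob_shift_iter n (A : set Ups) : measurable A ->
  P ((iter n shift3 : Ups -> Ups) @^-1` A) = P A.
Proof.
elim: n A => [//|n IH] A mA.
have mS : measurable ((shift3 : Ups -> Ups) @^-1` A).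
  exact: (measurable_preshift 1 mA).
by rewrite -[RHS]prob_shift // -(IH _ mS).
Qed.

(* The set [B] of codes never showing the word lies in the part of
   [sigma^-l B] outside [prefix_set l w], so [P B <= (1 - 3^-l) P B]. *)
Lemma prefix_infinitely_often l w (A : set Ups) : measurable A ->
  (forall b, (forall N, exists2 n, (N <= n)%N & prefix_set l w (sh n b)) -> A b) ->
  P A = 1%E.
Proof.
move=> mA hA; have mp := measurable_prefix_set l w.
pose B : set Ups := \bigcap_n (~` ((iter n shift3 : Ups -> Ups) @^-1` prefix_set l w)).
have mB : measurable B.
  apply: bigcap_measurable => [|n _]; first by exists 0%N.
  by apply: measurableC; exact: measurable_preshift.
have PB : P B = 0%E.
  have mI : measurable (prefix_set l w `&` (iter l shift3 : Ups -> Ups) @^-1` B).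
    by apply: measurableI => //; exact: measurable_preshift.
  have mD : measurable ((iter l shift3 : Ups -> Ups) @^-1` B).
    exact: measurable_preshift.
  have h1 : fine (P B) + fine (P (prefix_set l w `&` (iter l shift3 : Ups -> Ups) @^-1` B))
     <= fine (P B).
    rewrite -[leRHS](congr1 fine (prob_shift_iter l mB)) -fineD ?fin_num_measure //.
    rewrite -measureU //; last first.
      rewrite -subset0 => b [Bb [pb _]]; exact: (Bb 0%N I pb).
    apply: prob_le; rewrite //; first exact: measurableU.
    move=> b [Bb n _ /=|[_]//]; rewrite -iterD; exact: (Bb (n + l)%N I).
  move: h1; rewrite prob_prefix_shift // fineM ?fin_num_measure //= => h1.
  have t0 : 0 < 3%:R ^- l :> R by rewrite invr_gt0 exprn_gt0.
  have b0 : fine (P B) = 0 by have := prob_ge0 P B; nra.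
  by rewrite -[P B]fineK ?fin_num_measure // b0.
have PA : P (~` A) = 0%E.
  apply: measure_negligible; first exact: measurableC.
  (* A code outside [A] stops showing the word after some time [N], so its [N]-th shift lies in [B];
     countably many null sets remain. *)
  have : ~` A `<=` \bigcup_N ((iter N shift3 : Ups -> Ups) @^-1` B).
    move=> b nAb; apply: contrapT => nb; apply: nAb; apply: hA => N.
    apply: contrapT => h; apply: nb; exists N => // n _ /= hn; apply: h.
    by exists (n + N)%N; [exact: leq_addl|rewrite iterD].
  move/negligibleS; apply; apply: negligible_bigcup => N; exists ((iter N shift3 : Ups -> Ups) @^-1` B).
  split=> //; first exact: measurable_preshift.
  exact: etrans (prob_shift_iter N mB) PB.
have := probability_setC P mA; rewrite PA => h.
have : fine (1 - P A)%E = 0 by rewrite -h.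
rewrite fineB ?fin_num_measure //= => h2.
have {}h2 : fine (P A) = 1 by lra.
by rewrite -[P A]fineK ?fin_num_measure // h2.
Qed.

Lemma prob_setI1 (A B : set Ups) : measurable A -> measurable B ->
  P A = 1%E -> P B = 1%E -> P (A `&` B) = 1%E.
Proof.
move=> mA mB PA PB; have := prob_full mB PB mA; rewrite PA /= => h.
by rewrite -[LHS]fineK ?h // fin_num_measure //; exact: measurableI.
Qed.

Variable beta : R.
Hypotheses (beta1 : 1 < beta) (beta32 : beta < 3 / 2)
  (beta3 : beta ^+ 3 < beta ^+ 2 + 1).
Local Notation c := ((beta - 1)^-1).
Local Notation wt := (wt beta).
Local Notation pt := (pt beta).

Let beta0 : 0 < beta. Proof. exact: lt_trans beta1. Qed.
Let c0 : 0 < c. Proof. by rewrite invr_gt0 subr_gt0. Qed.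

Lemma wt_cst i a : wt i (fun=> a) = (a == i)%:R * c.
Proof.
have := wt_rec beta1 i (fun=> a); rewrite /shift3 => h.
have bm : beta - 1 != 0 by rewrite subr_eq0 gt_eqF.
by apply: (mulIf bm); rewrite -mulrA mulVf // mulr1; move: h; lra.
Qed.

Lemma wt_step i b : wt i b = ((b 0%N == i)%:R + wt i (shift3 b)) / beta.
Proof. by rewrite wt_rec // addrC subrK mulrC mulKf // gt_eqF. Qed.

(** Weights of codes sharing [l] digits differ by at most [c * beta^-l]. Hence a strict inequality
    on the weights of [w] extends to a whole cylinder. *)
Lemma wt_close del (w : UpsT) : 0 < del -> exists l, forall i b,
  prefix_set l w b -> wt i w - del < wt i b /\ wt i b < wt i w + del.
Proof.
move=> del0.
have [l hl] : exists l, c * beta^-1 ^+ l < del.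
  have b1 : `|beta^-1| < 1 by rewrite ger0_norm ?invf_lt1 // invr_ge0 ltW.
  have /cvgrPdist_lt /(_ _ del0)[l _ /(_ l (leqnn l)) /=] := cvg_geometric c b1.
  rewrite sub0r normrN => h; exists l; apply: le_lt_trans h; exact: ler_norm.
exists l => i b hb.
have pbw : psum beta i b l = psum beta i w l.
  by apply: eq_bigr => k _; rewrite hb.
rewrite (wt_psum beta1 i b l) (wt_psum beta1 i w l) pbw.
have t0 : 0 <= beta^-1 ^+ l by rewrite exprn_ge0 // invr_ge0 ltW.
have /andP[h1 h2] := wt_bounds beta1 i (sh l b).
have /andP[h3 h4] := wt_bounds beta1 i (sh l w).
have g1 := mulr_ge0 t0 h1; have g3 := mulr_ge0 t0 h3.
have g2 := ler_wpM2l t0 h2; have g4 := ler_wpM2l t0 h4.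
by move: hl; rewrite mulrC => hl; split; lra.
Qed.

Lemma heavy_pt_wt i b : heavy beta i (pt b) = (beta^-1 <= wt i b).
Proof. by rewrite /heavy bary_pt. Qed.

Lemma prob_Zcode : P (Zcode beta) = 1%E.
Proof.
have bi0 : 0 < beta^-1 by rewrite invr_gt0.
have b0 : beta != 0 by rewrite gt_eqF.
(* In both words below digit 0 occurs only once, so coordinate 0 equals [1/beta] exactly and leaves
   no room for approximation; it is heavy because of the first digit itself, which a prefix of
   length [l.+1] always contains. *)
have heavy0 b : b 0%N = i0 -> heavy beta i0 (pt b).
  by move=> b0E; rewrite -b0E; exact: heavy_pt.
have io1 : exists l (w : UpsT), forall b, prefix_set l w b -> inC beta (pt b).
  (* The word 0 1 1 1 ...: coordinate 1 is [c / beta > 1 / beta] and coordinate 2 is 0, so nearby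
     codes lie in [C_01]. *)
  pose w : UpsT := fun n => if n is 0%N then i0 else i1.
  have w1 : wt i1 w = c / beta.
    by rewrite wt_step //= add0r; have := wt_cst i1 i1 => /= ->; rewrite mul1r.
  have w2 : wt i2 w = 0.
    by rewrite wt_step //= add0r; have := wt_cst i2 i1 => /= ->; rewrite !mul0r.
  have d1 : 0 < c / beta - beta^-1.
    rewrite subr_gt0 -[ltLHS]mul1r ltr_pM2r // -[ltRHS]div1r ltr_pdivlMr ?subr_gt0 //.
    by move: beta32; lra.
  have [l hl] := wt_close w (del := Num.min (c / beta - beta^-1) beta^-1)
    ltac:(by rewrite lt_min d1).
  exists l.+1, w => b hb; rewrite inC_heavy ?inS_pt //.
  have {}hl i := hl i b (fun k kl => hb k (ltnW kl)).
  have -> := heavy0 b (hb 0%N isT).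
  rewrite !heavy_pt_wt.
  have [h1 _] := hl i1; have [_ h2] := hl i2.
  have m1 : Num.min (c / beta - beta^-1) beta^-1 <= c / beta - beta^-1.
    by rewrite ge_min lexx.
  have m2 : Num.min (c / beta - beta^-1) beta^-1 <= beta^-1.
    by rewrite ge_min lexx orbT.
  have -> : beta^-1 <= wt i1 b by lra.
  by rewrite [beta^-1 <= wt i2 b]leNgt (_ : wt i2 b < beta^-1) //; lra.
have io2 : exists l (w : UpsT), forall b, prefix_set l w b -> inC012 beta (pt b).
  (* The word 0 1 2 1 2 2 2 ...: two digits 1 lift coordinate 1 above the threshold precisely when
     [beta^3 < beta^2 + 1], and the tail of digits 2 then suffices for coordinate 2. *)
  pose w : UpsT := fun n => match n with 0%N => i0 | 1%N | 3%N => i1 | _ => i2 end.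
  have wE i : wt i w = ((i0 == i)%:R + ((i1 == i)%:R + ((i2 == i)%:R +
      ((i1 == i)%:R + (i2 == i)%:R * c) / beta) / beta) / beta) / beta.
    by do 4!rewrite wt_step //=; rewrite -wt_cst.
  have w1 : 0 < wt i1 w - beta^-1.
    rewrite wE /= (_ : _ - _ = (beta ^+ 2 + 1 - beta ^+ 3) / beta ^+ 4); last first.
      by field; rewrite b0 subr_eq0 gt_eqF.
    by rewrite divr_gt0 ?exprn_gt0 // subr_gt0.
  have w2 : 0 < wt i2 w - beta^-1.
    rewrite wE /= (_ : _ - _ = (beta + c - beta ^+ 3) / beta ^+ 4); last first.
      by field; rewrite b0 subr_eq0 gt_eqF.
    rewrite divr_gt0 ?exprn_gt0 // subr_gt0.
    (* Multiplied by [beta - 1] this reads [beta^3 <= 2 beta^2 - 2 beta + 2], which follows from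
       [beta^3 < beta^2 + 1] and [(beta - 1)^2 >= 0]. *)
    have : beta ^+ 2 - beta + 1 <= c.
      rewrite -[leRHS]div1r ler_pdivlMr ?subr_gt0 //.
      have := beta3; have := sqr_ge0 (beta - 1); nra.
    have := beta3; lra.
  have [l hl] := wt_close w (del := Num.min (wt i1 w - beta^-1) (wt i2 w - beta^-1))
    ltac:(by rewrite lt_min w1).
  exists l.+1, w => b hb; rewrite inC012_heavy ?inS_pt //.
  have {}hl i := hl i b (fun k kl => hb k (ltnW kl)).
  have -> := heavy0 b (hb 0%N isT).
  rewrite !heavy_pt_wt; have [h1 _] := hl i1; have [h2 _] := hl i2.
  have m1 : Num.min (wt i1 w - beta^-1) (wt i2 w - beta^-1) <= wt i1 w - beta^-1.
    by rewrite ge_min lexx.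
  have m2 : Num.min (wt i1 w - beta^-1) (wt i2 w - beta^-1) <= wt i2 w - beta^-1.
    by rewrite ge_min lexx orbT.
  by apply/andP; split; lra.
have [l1 [v1 h1]] := io1; have [l2 [v2 h2]] := io2.
apply: prob_setI1.
- by apply: measurable_io => n; exact: obs_visits_inC.
- by apply: measurable_io => n; exact: obs_visits_inC012.
- apply: (prefix_infinitely_often (l := l1) (w := v1)).
    by apply: measurable_io => n; exact: obs_visits_inC.
  by move=> b hb N; have [n Nn hn] := hb N; exists n => //; exact: h1.
- apply: (prefix_infinitely_often (l := l2) (w := v2)).
    by apply: measurable_io => n; exact: obs_visits_inC012.
  by move=> b hb N; have [n Nn hn] := hb N; exists n => //; exact: h2.
Qed.

End CodeMeasure.

(** * Entropy of invariant measures *)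

Section EntropyOfKbeta.
Variables (R : realType) (beta : R).
Hypotheses (beta1 : 1 < beta) (beta32 : beta < 3 / 2).
Variable mu : probability (State R) R.
Hypotheses (muD : mu (Dom beta) = 1%E) (muK : mpreserving mu (Kbeta beta)).
Local Notation K := (Kbeta beta).
Local Notation phi := (phi beta).
Local Notation digit := (digit beta).
Local Notation mD := (@measurable_Dom R beta).
Local Notation mK := (measurable_Kbeta beta1 beta32).

(** The heavy pattern accompanies the digit because a digit reveals a coin only when the cell is
    known. *)
Definition digit_cell (x : State R) : 'I_3 * {ffun 'I_3 -> bool} :=
  (digit x, [ffun i => heavy beta i x.2]).

Lemma obs_digit_cell : obs digit_cell.
Proof.
apply: obs_pair; first exact: obs_digit.
by apply: obs_ffun => i; apply: obs_heavy;
  [exact: measurable_state_fst|exact: measurable_state_snd].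
Qed.

(** The digits stand for the position, which they determine on [Dom]; the coins are kept as they
    are. *)
Definition full_code (x : State R) (n : nat) : 'I_3 * bool * 'I_3 :=
  (phi x n, x.1.1 n, x.1.2 n).

Section Approximable.
Variables (L : Type) (g : State R -> nat -> L).
Hypothesis g_phi : forall N x y, agree g N x y ->
  forall i, (i < N)%N -> phi x i = phi y i.

(** Stated for any labelling that refines the digits, as it serves both [phi] and [full_code]. The
    sets with approximable preimage form a sigma-algebra containing the cylinders. *)
Lemma approximable_phi (B : set Ups) : measurable B ->
  approximable mu g (phi @^-1` B).
Proof.
have [h0 hC hU] := sigma_algebra_approximable mu g.
pose F : set (set Ups) := [set B | approximable mu g (phi @^-1` B)].
suff : <<s Ups_gen>> `<=` F by apply.
apply: smallest_sub.
  split => [|A FA|A FA]; rewrite /F /=.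
  - by rewrite preimage_set0.
  - by have := hC _ FA; rewrite !setTD.
  - by rewrite preimage_bigcup; exact: hU.
move=> _ [n [w ->]]; apply: cylindric_approximable.
  rewrite -[X in measurable X]setTI; apply: measurable_phi => //.
  by apply: sub_sigma_algebra; exists n, w.
by exists n => x y /g_phi xy xw i; rewrite -xy // xw.
Qed.

End Approximable.

Lemma rate_digit_prefix (F : finType) (X : State R -> F) N h : obs X ->
  (forall x y, agree phi N x y -> X x = X y) ->
  rate_le mu K digit h -> rate_le mu K X h.
Proof.
move=> mX hX rd; apply: (rate_prefix mK muK mD muD _ mX _ rd (N := N)).
- by move=> x; exact: Dom_Kbeta.
- exact: obs_digit.
- move=> x y _ _ /ffunP xy; apply: hX => i iN.
  by have := xy (Ordinal iN); rewrite !ffunE.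
Qed.

Lemma rate_digit_cell h : rate_le mu K digit h -> rate_le mu K digit_cell h.
Proof.
move=> rd; apply: (rate_approximable (g := phi) mD muD mK muK); last first.
  by move=> X N mX hX; exact: (rate_digit_prefix mX hX rd).
move=> a; pose A (b : Ups) := (b 0%N, [ffun i => heavy beta i (pt beta b)]).
have mA : obs A.
  apply: obs_pair; first exact: obs_ups.
  apply: obs_ffun => i.
  exact: (@obs_heavy _ _ _ Ups (pt beta) (measurable_wt beta1 i1 0)
    (measurable_wt beta1 i2 0)).
apply: (approximable_eq_on mD muD (A' := phi @^-1` (A @^-1` [set a]))).
- exact: obs_digit_cell.
- by apply: approximable_phi => // N x y xy i iN; exact: xy.
- by move=> x Dx; rewrite /= /A /digit_cell pt_phi.
Qed.

(** A step of [K] drops at most the first coin of either kind; [digit_cell x] reveals a dropped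
    coin, and the others are still present in [K x]. *)
Lemma prefix_backward N (x y : State R) : Dom beta x -> Dom beta y ->
  digit_cell x = digit_cell y ->
  (forall j, (j < N)%N -> (K x).1.1 j = (K y).1.1 j /\ (K x).1.2 j = (K y).1.2 j) ->
  forall j, (j < N)%N -> x.1.1 j = y.1.1 j /\ x.1.2 j = y.1.2 j.
Proof.
move=> Dx Dy [dxy /ffunP hxy] Kxy.
have {}hxy i : heavy beta i x.2 = heavy beta i y.2 by have := hxy i; rewrite !ffunE.
have Cxy : inC beta x.2 = inC beta y.2 by rewrite !inC_heavy // !hxy.
have Exy : inC012 beta x.2 = inC012 beta y.2 by rewrite !inC012_heavy // !hxy.
have bitxy a : bit beta x.2 a = bit beta y.2 a.
  have [_ _ _ ex _] := cellsE beta1 Dx; have [_ _ _ ey _] := cellsE beta1 Dy.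
  by rewrite /bit ex ey !hxy.
move: Kxy; rewrite !KbetaE /= -Cxy -Exy => Kxy j jN; split.
  have [Cx|nCx] := boolP (inC beta x.2); last by have [] := Kxy j jN; rewrite (negbTE nCx).
  case: j jN => [|j] jN.
    have Cy : inC beta y.2 by rewrite -Cxy.
    by rewrite -(bit_digit beta1 beta32 Dx Cx) -(bit_digit beta1 beta32 Dy Cy) bitxy dxy.
  by have [] := Kxy j (ltnW jN); rewrite Cx.
have [Ex|nEx] := boolP (~~ inC beta x.2 && inC012 beta x.2); last first.
  by have [_] := Kxy j jN; rewrite (negbTE nEx).
have Ex2 : inC012 beta x.2 by case/andP: Ex.
case: j jN => [|j] jN.
  have Ey2 : inC012 beta y.2 by rewrite -Exy.
  by rewrite -(digit_inC012 beta1 beta32 Dx Ex2) -(digit_inC012 beta1 beta32 Dy Ey2).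
by have [_] := Kxy j (ltnW jN); rewrite Ex.
Qed.

Lemma rate_full_code (F : finType) (X : State R -> F) N h : obs X ->
  (forall x y, agree full_code N x y -> X x = X y) ->
  rate_le mu K digit h -> rate_le mu K X h.
Proof.
move=> mX hX rd.
(* The unread coins at the final time: their law is unknown, but they take finitely many values
   independently of [n]. *)
pose win (x : State R) : {ffun 'I_N -> bool} * {ffun 'I_N -> 'I_3} :=
  ([ffun i : 'I_N => x.1.1 i], [ffun i : 'I_N => x.1.2 i]).
apply: (rate_window mK muK mD muD mX obs_digit_cell (c := win) (N := N) _
  (rate_digit_cell rd)).
  by apply: obs_pair; apply: obs_ffun => i;
    [exact: obs_state_om|exact: obs_state_up].
move=> n x y Dx Dy [/ffunP Axy /ffunP oxy /ffunP uxy].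
have {}Axy i : (i < n + N)%N -> digit_cell (iter i K x) = digit_cell (iter i K y).
  by move=> iN; have := Axy (Ordinal iN); rewrite !ffunE.
(* Descending induction on the time, starting from time [n], where [win] supplies the coins. *)
have back k : (k <= n)%N -> forall j, (j < N)%N ->
    (iter (n - k) K x).1.1 j = (iter (n - k) K y).1.1 j /\
    (iter (n - k) K x).1.2 j = (iter (n - k) K y).1.2 j.
  elim: k => [_ j jN|k IH kn].
    by have := oxy (Ordinal jN); have := uxy (Ordinal jN); rewrite !ffunE subn0.
  apply: prefix_backward; [exact: Dom_iter|exact: Dom_iter| |].
    by apply: Axy; lia.
  move=> j jN; rewrite -!iterS (_ : (n - k.+1).+1 = n - k)%N; last by lia.
  by apply: IH => //; exact: ltnW.
apply/ffunP => i; rewrite !ffunE; apply: hX => j jN.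
have in_ := ltn_ord i.
have := back (n - i)%N (leq_subr _ _) j jN; rewrite subKn; last exact: ltnW.
move=> [e1 e2]; rewrite /full_code e1 e2; congr (_, _, _).
rewrite /Defs.phi -!iterD.
by have [] : digit_cell (iter (j + i) K x) = digit_cell (iter (j + i) K y)
  by apply: Axy; lia.
Qed.

(** For a generating box the coin conditions are cylindric; on [Dom] the condition on the position
    is a Borel condition on the weights of the code. *)
Lemma approximable_full_code (A : set (State R)) :
  measurable A -> approximable mu full_code A.
Proof.
have full_phi N x y : agree full_code N x y ->
    forall i, (i < N)%N -> phi x i = phi y i.
  by move=> xy i /xy [].
suff : <<s @State_gen R >> `<=` approximable mu full_code by apply.
apply: smallest_sub; first exact: sigma_algebra_approximable.
move=> _ [n [u [k [w [a1 [b1 [a2 [b2 ->]]]]]]]].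
pose rect : set Ups := [set b | a1 < wt beta i1 b < b1 /\ a2 < wt beta i2 b < b2].
have mrect : measurable rect.
  rewrite (_ : rect = (fun b : Ups => wt beta i1 b) @^-1` `]a1, b1[ `&`
                      (fun b : Ups => wt beta i2 b) @^-1` `]a2, b2[).
    apply: measurableI; rewrite -[X in measurable X]setTI.
      by apply: (@measurable_wt _ _ beta1 i1 0) => //; exact: measurable_itv.
    by apply: (@measurable_wt _ _ beta1 i2 0) => //; exact: measurable_itv.
  by apply/seteqP; split=> b /=; rewrite !in_itv.
apply: (approximable_eq_on mD muD (A' :=
    [set x : State R | cylB u x.1.1 /\ cyl3 w x.1.2] `&` phi @^-1` rect)).
- exact: measurable_state_box.
- apply: approximableI; last exact: approximable_phi.
  apply: cylindric_approximable; first exact: measurable_state_cyl.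
  exists (maxn n k) => x y xy [h1 h2]; split=> i.
    have [_ <- _] := xy i (leq_trans (ltn_ord i) (leq_maxl _ _)); exact: h1.
  have [_ _ <-] := xy i (leq_trans (ltn_ord i) (leq_maxr _ _)); exact: h2.
- by move=> x Dx; rewrite /rect /= -(pt_phi beta1 beta32 Dx) /=; tauto.
Qed.

Lemma rate_obs (F : finType) (X : State R -> F) h : obs X ->
  rate_le mu K digit h -> rate_le mu K X h.
Proof.
move=> mX rd; apply: (rate_approximable (g := full_code) mD muD mK muK).
  by move=> a; apply: approximable_full_code; exact: mX.
by move=> X' N mX' hX'; exact: (rate_full_code mX' hX' rd).
Qed.

Lemma join_cell_block k n (P : 'I_k -> set (State R)) (X : State R -> 'I_k) w :
  (forall i, P i = X @^-1` [set i]) ->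
  join_cell K P w = block K X n @^-1` [set w].
Proof.
move=> PX; apply/seteqP; split=> x /= h.
  by apply/ffunP => i; rewrite ffunE; have := h i; rewrite PX.
by move=> i; rewrite PX /= -h ffunE.
Qed.

Lemma Hjoin_block k n (P : 'I_k -> set (State R)) (X : State R -> 'I_k) :
  (forall i, P i = X @^-1` [set i]) ->
  Hjoin mu K n P = ent mu (block K X n).
Proof.
by move=> PX; apply: eq_bigr => w _; rewrite (join_cell_block _ PX).
Qed.

Lemma partition_obs k (P : 'I_k -> set (State R)) : is_mpartition P ->
  exists X : State R -> 'I_k, obs X /\ forall i, P i = X @^-1` [set i].
Proof.
move=> [mP disj cover].
have [X hX] : {X : State R -> 'I_k & forall x, P (X x) x}.
  apply: (@choice _ _ (fun x i => P i x)) => x.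
  have [i _ Pix] : (\bigcup_(i in [set: 'I_k]) P i) x by rewrite cover.
  by exists i.
have PX i : P i = X @^-1` [set i].
  apply/seteqP; split=> x /=; last by move=> <-.
  move=> Pix; apply/eqP/negPn/negP => ne.
  by have : (P (X x) `&` P i) x by []; rewrite disj.
by exists X; split=> // i; rewrite -PX.
Qed.

Lemma ent_part_le k (P : 'I_k -> set (State R)) h : is_mpartition P -> 0 <= h ->
  rate_le mu K digit h -> ent_part mu K P <= h.
Proof.
move=> hP h0 rd; have [X [mX PX]] := partition_obs hP.
have rX := rate_obs mX rd.
rewrite /ent_part; set u := fun n => _.
have [cu|ncu] := pselect (cvgn u).
  apply/ler_addgt0Pr => e e0; apply: limr_le => //.
  have [N hN] := rX e e0; exists N => // n /= Nn.
  rewrite /u (Hjoin_block _ PX) ler_pdivrMr // mulrC.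
  by apply: hN; exact: leq_trans (leqnSn n).
(* [lim] is the junk value [0] along a sequence without limit *)
rewrite /lim /lim_in xgetPN // => l ul; apply: ncu; apply/cvg_ex.
by exists l.
Qed.

Lemma ks_entropy_le n : (0 < n)%N ->
  (ks_entropy mu K <= (ent mu (block K digit n) / n%:R)%:E)%E.
Proof.
move=> n0; apply: ge_ereal_sup => _ [k [P [hP ->]]]; rewrite lee_fin.
have md : obs digit by exact: obs_digit.
apply: ent_part_le => //; last exact: (rate_block mK muK mD muD md n0).
by rewrite divr_ge0 // ent_ge0 //; exact: (obs_block mK md).
Qed.

Lemma ks_entropy_le_ln3 : (ks_entropy mu K <= (ln 3%:R)%:E)%E.
Proof.
apply: (le_trans (ks_entropy_le (isT : (0 < 1)%N))); rewrite divr1 lee_fin.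
have d0 : obs digit by exact: obs_digit.
have md : obs (block K digit 1) by exact: (obs_block mK d0).
by have [+ _] := ent_uniform mu md; rewrite card_ffun !card_ord.
Qed.

Lemma prob_phi_cyl : ((ln 3%:R)%:E <= ks_entropy mu K)%E ->
  forall n (w : n.-tuple 'I_3), mu (phi @^-1` cyl3 w) = (3%:R ^- n)%:E.
Proof.
move=> hmax n w.
have d0 : obs digit by exact: obs_digit.
have md : obs (block K digit n) by exact: (obs_block mK d0).
have [_ uni] := ent_uniform mu md.
have hent : n%:R * ln 3%:R <= ent mu (block K digit n).
  (* The empty word is treated apart because the entropy bound divides by the length. *)
  case: n {w uni} md => [|n] md; first by rewrite mul0r ent_ge0.
  have := le_trans hmax (ks_entropy_le (isT : (0 < n.+1)%N)).
  by rewrite lee_fin ler_pdivlMr // mulrC.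
have cE : #|{ffun 'I_n -> 'I_3}|%:R = 3%:R ^+ n :> R.
  by rewrite card_ffun !card_ord natrX.
have := uni _ [ffun i => tnth w i].
rewrite cE lnXn // -[_ *+ n]mulr_natl => /(_ hent).
rewrite (_ : _ @^-1` _ = phi @^-1` cyl3 w); last first.
  apply/seteqP; split=> x /=.
    by move=> /ffunP h i; have := h i; rewrite !ffunE.
  by move=> h; apply/ffunP => i; rewrite !ffunE; exact: (h i).
move=> <-; rewrite fineK // fin_num_measure //.
rewrite -[X in measurable X]setTI; apply: measurable_phi => //.
by apply: sub_sigma_algebra; exists n, w.
Qed.

End EntropyOfKbeta.

(** * The measure of maximal entropy *)

(** The polynomial [x^3 - x^2 - 1] increases beyond 1; the last factor in the identity is its
    difference quotient between [beta] and [bstar]. *)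
Lemma below_root (R : realType) (bstar beta : R) :
  bstar ^+ 3 - bstar ^+ 2 - 1 = 0 -> 1 < beta -> beta < bstar ->
  beta ^+ 3 < beta ^+ 2 + 1.
Proof.
move=> hb b1 bb; have bs1 : 1 < bstar by exact: lt_trans bb.
have -> : beta ^+ 2 + 1 = beta ^+ 3 +
    (bstar - beta) * (bstar * (bstar - 1) + beta * (beta - 1) + bstar * beta).
  by transitivity (beta ^+ 2 + 1 + (bstar ^+ 3 - bstar ^+ 2 - 1));
    [rewrite hb addr0|ring].
rewrite ltrDl mulr_gt0 ?subr_gt0 // !addr_gt0 // mulr_gt0 ?subr_gt0 //;
  exact: lt_trans ltr01 _.
Qed.

(** From [3/2] on, [x^2 (x - 1)] is at least [9/8], which exceeds 1. *)
Lemma lt_three_halves (R : realType) (beta : R) :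
  beta ^+ 3 < beta ^+ 2 + 1 -> beta < 3 / 2.
Proof.
move=> h; rewrite ltNge; apply/negP => b32.
have h2 : (9 / 4 : R) <= beta ^+ 2.
  by rewrite (_ : 9 / 4 = (3 / 2) ^+ 2) ?lerXn2r ?nnegrE //; [lra|field].
have : (9 / 4 : R) * 2^-1 <= beta ^+ 2 * (beta - 1) by apply: ler_pM; lra.
rewrite mulrBr mulr1 -exprSr; lra.
Qed.

Section MaximalEntropy.
Variables (R : realType) (beta : R).
Hypotheses (beta1 : 1 < beta) (beta3 : beta ^+ 3 < beta ^+ 2 + 1).
Let beta32 := lt_three_halves beta3.
Variable P : probability Ups R.
Hypothesis hP : forall (n : nat) (w : n.-tuple 'I_3), P (cyl3 w) = (3%:R ^- n)%:E.
Local Notation K := (Kbeta beta).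
Local Notation phi := (phi beta).
Local Notation psi := (psi beta).

Definition nu_beta : probability (State R) R :=
  distribution P (mfun_Sub (mem_set (measurable_psi beta1))).

Lemma nu_betaE (A : set (State R)) : nu_beta A = P (psi @^-1` A).
Proof. by []. Qed.

Lemma measurable_psi_preimage (A : set (State R)) : measurable A ->
  measurable (psi @^-1` A : set Ups).
Proof.
by move=> mA; rewrite -[X in measurable X]setTI; exact: measurable_psi.
Qed.

Lemma probE_Zcode (A B : set Ups) : measurable A -> measurable B ->
  A `&` Zcode beta = B `&` Zcode beta -> P A = P B.
Proof.
move=> mA mB AB; have mZ := measurable_Zcode beta1.
have PZ := prob_Zcode hP beta1 beta32 beta3.
rewrite -[LHS]fineK ?fin_num_measure // -[RHS]fineK ?fin_num_measure //.
by rewrite -(prob_full mZ PZ mA) -(prob_full mZ PZ mB) AB.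
Qed.

Lemma nu_beta_Dom : nu_beta (Dom beta) = 1%E.
Proof.
rewrite nu_betaE (_ : psi @^-1` Dom beta = setT) ?probability_setT //.
by apply/seteqP; split=> // b _; exact: Dom_psi.
Qed.

Lemma nu_beta_image (A : set (State R)) : measurable A ->
  measurable (phi @` (Zset beta `&` A) : set Ups) /\
  nu_beta A = P (phi @` (Zset beta `&` A)).
Proof.
move=> mA; rewrite phi_image // nu_betaE.
have mZ := measurable_Zcode beta1; have mpsi := measurable_psi_preimage mA.
split; first exact: measurableI.
apply: probE_Zcode => //; first exact: measurableI.
by rewrite setIAC setIid setIC.
Qed.

(** On the full set [Zcode] the section intertwines the shift with [K], and [P] is
    shift-invariant. *)
Lemma nu_beta_preserving : mpreserving nu_beta K.
Proof.
move=> A mA; have mK : measurable (K @^-1` A).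
  by rewrite -[X in measurable X]setTI; exact: measurable_Kbeta.
have mpsi := measurable_psi_preimage mA.
rewrite !nu_betaE -[RHS](prob_shift hP mpsi); apply: probE_Zcode.
- exact: measurable_psi_preimage.
- exact: (measurable_preshift 1 mpsi).
- by apply/seteqP; split=> b /= [h Zb]; split=> //; move: h; rewrite psi_shift.
Qed.

(** The digit partition already attains the value: as [phi (psi b) = b], its joins pull back under
    [psi] to cylinders of measure [3^-n], and the entropy quotient is constantly [ln 3]. *)
Lemma ks_entropy_nu_beta : ((ln 3%:R)%:E <= ks_entropy nu_beta K)%E.
Proof.
apply: ereal_sup_ubound; pose D i := digit beta @^-1` [set i] : set (State R).
exists 3%N, D; split.
  split=> [i|i j /eqP ij|]; first exact: obs_digit.
    by rewrite -subset0 => x [/= di dj]; case: ij; rewrite -di -dj.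
  by apply/seteqP; split=> // x _; exists (digit beta x).
congr (_%:E); have HE n : Hjoin nu_beta K n.+1 D / n.+1%:R = ln 3%:R.
  rewrite /Hjoin (eq_bigr (fun=> 3%:R ^- n.+1 * (n.+1%:R * ln 3%:R))); last first.
    move=> w _; rewrite nu_betaE (_ : _ @^-1` _ = cyl3 [tuple w i | i < n.+1]).
      rewrite hP /= eta_entE lnV ?posrE ?exprn_gt0 // lnXn //.
      by rewrite -[_ *+ n.+1]mulr_natl mulrN opprK.
    apply/seteqP; split=> b /= h i.
      have := h i; rewrite /D /= -[digit beta _]/(phi (psi b) i) psiK // => ->.
      by rewrite tnth_mktuple.
    by rewrite /D /= -[digit beta _]/(phi (psi b) i) psiK // h tnth_mktuple.
  rewrite sumr_const card_ffun !card_ord -[_ *+ _]mulr_natl natrX mulrA.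
  by rewrite divff ?expf_neq0 ?pnatr_eq0 // mul1r mulrC mulKf ?pnatr_eq0.
apply/esym/cvg_lim => //; rewrite (_ : (fun n => _) = fun=> ln 3%:R).
  exact: cvg_cst.
by apply/funext => n; exact: HE.
Qed.

Lemma maximal_entropy_unique (mu : probability (State R) R) :
  mu (Dom beta) = 1%E -> mpreserving mu K ->
  ((ln 3%:R)%:E <= ks_entropy mu K)%E ->
  forall A, measurable A -> mu A = nu_beta A.
Proof.
move=> muD muK hmax A mA.
have mphi := measurable_phi beta1 beta32.
have muphi (B : set Ups) : measurable B -> mu (phi @^-1` B) = P B.
  move=> mB; pose m1 := distribution mu (mfun_Sub (mem_set mphi)).
  apply: (ups_measure_ext (m1 := m1) (m2 := P) _ _ mB).
    by move=> n w; apply: etrans (esym (hP w)); exact: prob_phi_cyl.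
  by apply: (le_lt_trans (probability_le1 m1 measurableT)); rewrite ltry.
have mZ := measurable_Zcode beta1; have mpsi := measurable_psi_preimage mA.
have mpre (B : set Ups) : measurable B -> measurable (phi @^-1` B).
  by move=> mB; rewrite -[X in measurable X]setTI; exact: mphi.
have mD := @measurable_Dom R beta.
pose Z := Dom beta `&` phi @^-1` Zcode beta.
have muZ : mu Z = 1%E.
  have e : fine (mu (phi @^-1` Zcode beta)) = 1.
    by rewrite muphi // (prob_Zcode hP beta1 beta32 beta3).
  have := prob_full mD muD (mpre _ mZ); rewrite e setIC => h.
  rewrite -[LHS]fineK ?h // fin_num_measure //.
  by apply: measurableI => //; exact: mpre.
have mZ' : measurable Z by apply: measurableI => //; exact: mpre.
rewrite nu_betaE -muphi //.
rewrite -[LHS]fineK ?fin_num_measure // -[RHS]fineK ?fin_num_measure //; last exact: mpre.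
rewrite -(prob_full mZ' muZ mA) -(prob_full mZ' muZ (mpre _ mpsi)).
(* On [Z] one has [psi (phi x) = x], so [A] and its preimage under [psi] and then [phi] have the
   same trace there. *)
congr (fine (mu _))%:E; apply/seteqP; split=> x /= [Ax [Dx Zx]]; split=> //;
  by move: Ax; rewrite /= phiK //; apply/Zset_phi.
Qed.

End MaximalEntropy.

Theorem theorem4p10 (R : realType) (bstar beta : R) :
  bstar ^+ 3 - bstar ^+ 2 - 1 = 0 ->
  1 < beta -> beta < bstar ->
  forall P : probability Ups R,
  (forall (n : nat) (w : n.-tuple 'I_3), P (cyl3 w) = ((3%:R ^- n)%:E)%E) ->
  exists nu : probability (State R) R,
  [/\ nu (Dom beta) = 1%E,
      (forall A : set (State R), measurable A ->
         measurable (phi beta @` (Zset beta `&` A)) /\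
         nu A = P (phi beta @` (Zset beta `&` A))),
      mpreserving nu (Kbeta beta),
      (forall mu : probability (State R) R,
         mu (Dom beta) = 1%E -> mpreserving mu (Kbeta beta) ->
         (ks_entropy mu (Kbeta beta) <= ks_entropy nu (Kbeta beta))%E)
    & (forall mu : probability (State R) R,
         mu (Dom beta) = 1%E -> mpreserving mu (Kbeta beta) ->
         (forall mu' : probability (State R) R,
            mu' (Dom beta) = 1%E -> mpreserving mu' (Kbeta beta) ->
            (ks_entropy mu' (Kbeta beta) <= ks_entropy mu (Kbeta beta))%E) ->
         forall A : set (State R), measurable A -> mu A = nu A)].

Proof.
move=> hb beta1 bb P hP; have beta3 := below_root hb beta1 bb.
have beta32 := lt_three_halves beta3.
exists (nu_beta beta1 P); split.
- exact: nu_beta_Dom.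
- by move=> A mA; exact: nu_beta_image.
- exact: nu_beta_preserving.
- move=> mu muD muK; apply: (le_trans (ks_entropy_le_ln3 beta1 beta32 muD muK)).
  exact: ks_entropy_nu_beta.
- move=> mu muD muK hmax A mA; apply: maximal_entropy_unique => //.
  apply: le_trans (hmax _ (nu_beta_Dom beta1 P) _).
    exact: ks_entropy_nu_beta.
  exact: nu_beta_preserving.
Qed.
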